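(* (Adequacy.) Let $\mathbf C_!^{\mathcal S}$ be any linear category with biproducts equipped with a semiring monomorphism $\mathcal S\to\mathrm{Hom}(I,I)$, and let $[\![\cdot]\!]$ be the interpretation of the $\mathcal L_!^{\mathcal S}$-calculus in it. Let $\vdash t:A$ and $\vdash r:A$ (both contexts empty). If $[\![t]\!]=[\![r]\!]$, then $t\equiv r$, where $\equiv$ denotes observational equivalence: for every elimination context $K$ with ${\_}^A\vdash K:\mathfrak 1$ and every scalar $a$, $K[t]\longrightarrow^* a.\star$ if and only if $K[r]\longrightarrow^* a.\star$.
   Context: The $\mathcal L_!^{\mathcal S}$-calculus. Let $\mathcal S$ be a commutative semiring, whose elements are called scalars. Propositions are generated by $A ::= \mathfrak 1\mid A\multimap A\mid A\otimes A\mid\top\mid\mathfrak 0\mid A\mathbin{\&}A\mid A\oplus A\mid {!}A$. Proof-terms, taken modulo $\alpha$-equivalence, are generated by (with $a\in\mathcal S$) $t ::= x\mid t\boxplus u\mid a\bullet t\mid a.\star\mid\delta_{\mathfrak 1}(t,u)\mid\lambda x^A.t\mid t\,u\mid t\otimes u\mid\delta_\otimes(t,x^Ay^B.u)\mid\langle\rangle\mid\delta_{\mathfrak 0}(t)\mid\langle t,u\rangle\mid\delta_{\&}^1(t,x^A.u)\mid\delta_{\&}^2(t,x^B.u)\mid\mathit{inl}(t)\mid\mathit{inr}(t)\mid\delta_\oplus(t,x^A.u,y^B.v)\mid {!}t\mid\delta_!(t,x^A.u)$. Variables before a dot are bound in the term after it; $(u/x)t$ is capture-avoiding substitution. Judgements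 $\Upsilon;\Gamma\vdash t:A$ have an intuitionistic context $\Upsilon$ and a linear context $\Gamma$, considered up to permutation; $\vdash t:A$ means $\varnothing;\varnothing\vdash t:A$. Reduction $\longrightarrow$ (reflexive-transitive closure $\longrightarrow^*$) is the closure under arbitrary term contexts of: $\delta_{\mathfrak 1}(a.\star,t)\to a\bullet t$; $(\lambda x^A.t)\,u\to(u/x)t$; $\delta_\otimes(u\otimes v,x^Ay^B.w)\to(u/x,v/y)w$; $\delta_{\&}^i(\langle t_1,t_2\rangle,x^A.v)\to(t_i/x)v$ ($i=1,2$); $\delta_\oplus(\mathit{inl}(t),x^A.v,y^B.w)\to(t/x)v$; $\delta_\oplus(\mathit{inr}(u),x^A.v,y^B.w)\to(u/y)w$; $\delta_!({!}t,x^A.u)\to(t/x)u$; $a.\star\boxplus b.\star\to(a+b).\star$; $(\lambda x^A.t)\boxplus(\lambda x^A.u)\to\lambda x^A.(t\boxplus u)$; $\delta_\otimes(t\boxplus u,x^Ay^B.v)\to\delta_\otimes(t,x^Ay^B.v)\boxplus\delta_\otimes(u,x^Ay^B.v)$; $\langle\rangle\boxplus\langle\rangle\to\langle\rangle$; $\langle t,u\rangle\boxplus\langle v,w\rangle\to\langle t\boxplus v,u\boxplus w\rangle$; $\delta_\oplus(t\boxplus u,x^A.v,y^B.w)\to\delta_\oplus(t,x^A.v,y^B.w)\boxplus\delta_\oplus(u,x^A.v,y^B.w)$; $\delta_!(t\boxplus u,x^A.v)\to\delta_!(t,x^A.v)\boxplus\delta_!(u,x^A.v)$; $a\bullet b.\star\to(a\times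 b).\star$; $a\bullet\lambda x^A.t\to\lambda x^A.a\bullet t$; $\delta_\otimes(a\bullet t,x^Ay^B.v)\to a\bullet\delta_\otimes(t,x^Ay^B.v)$; $a\bullet\langle\rangle\to\langle\rangle$; $a\bullet\langle t,u\rangle\to\langle a\bullet t,a\bullet u\rangle$; $\delta_\oplus(a\bullet t,x^A.v,y^B.w)\to a\bullet\delta_\oplus(t,x^A.v,y^B.w)$; $\delta_!(a\bullet t,x^A.v)\to a\bullet\delta_!(t,x^A.v)$. Size of propositions: $|\mathfrak 1|=|\top|=|\mathfrak 0|=1$; $|A\multimap B|=|A\otimes B|=|A\mathbin{\&}B|=|A\oplus B|=|A|+|B|$; $|{!}A|=|A|+1$. Elimination contexts, with $\_$ a distinguished variable, are the terms generated by $K ::= \_\mid K\,u\mid\delta_\otimes(K,x^Ay^B.v)\mid\delta_{\&}^1(K,x^A.r)\mid\delta_{\&}^2(K,x^B.r)\mid\delta_\oplus(K,x^A.r,y^B.s)\mid\delta_!(K,x^A.r)$, where: in $\delta_\otimes(K,x^Ay^B.v)$, $\varnothing;x^A,y^B\vdash v:C$ with $|C|<|A\otimes B|$; in $\delta_\oplus(K,x^A.r,y^B.s)$, $\varnothing;x^A\vdash r:C$ and $\varnothing;y^B\vdash s:C$ with $|C|<|A\oplus B|$; in $\delta_!(K,x^A.r)$, $x^A;\varnothing\vdash r:B$ with $|B|<|{!}A|$. $K[t]$ is $(t/\_)K$. ${\_}^A\vdash K:\mathfrak 1$ means ${\_}^A;\varnothing\vdash K:\mathfrak 1$ or $\varnothing;{\_}^A\vdash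 K:\mathfrak 1$. Linear category. A symmetric monoidal comonad on a symmetric monoidal category $(\mathcal C,\otimes,I)$ is $({!},\varepsilon,\delta,m_{A,B},m_I)$ where $({!},\varepsilon:{!}\Rightarrow Id,\delta:{!}\Rightarrow{!}{!})$ is a comonad, ${!}$ is a (lax) symmetric monoidal functor with structure maps $m_{A,B}:{!}A\otimes{!}B\to{!}(A\otimes B)$, $m_I:I\to{!}I$, and $\varepsilon,\delta$ are monoidal natural transformations. A coalgebra is $(A,h:A\to{!}A)$ with $\delta_A\circ h={!}h\circ h$ and $\varepsilon_A\circ h=id$; a coalgebra morphism $(A,h)\to(A',h')$ is $f:A\to A'$ with ${!}f\circ h=h'\circ f$. A linear category is a symmetric monoidal closed category with finite products and coproducts and a symmetric monoidal comonad such that: (1) there are monoidal natural transformations with components $e_A:{!}A\to I$, $d_A:{!}A\to{!}A\otimes{!}A$ such that each $({!}A,d_A,e_A)$ is a commutative comonoid and $e_A:({!}A,\delta_A)\to(I,m_I)$, $d_A:({!}A,\delta_A)\to({!}A\otimes{!}A,m\circ(\delta_A\otimes\delta_A))$ are coalgebra morphisms; (2) every coalgebra morphism $({!}A,\delta_A)\to({!}B,\delta_B)$ is a comonoid morphism. The model. $\mathbf C_!^{\mathcal S}$ is a linear category with biproduct $\oplus$ (projections $\pi_i$, injections $i_i$, zero object $\mathbf 0$) with a semiring monomorphism $(\!|\cdot|\!):\mathcal S\to\mathrm{Hom}(I,I)$ (addition $f+g=\nabla\circ(f\oplus g)\circ\Delta$, product composition). $\lambda,\rho,\sigma$ are the left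 unitor, right unitor and symmetry; $\Delta=\langle id,id\rangle$, $\nabla=[id,id]$; $[A\to-]$ is the internal hom, with unit $\eta_A:X\to[A\to X\otimes A]$ and evaluation $ev:[A\to B]\otimes A\to B$. For $a:I\to I$, $\hat a_A=\rho_A\circ(id\otimes a)\circ\rho_A^{-1}:A\to A$. $dist=\langle\pi_1\otimes id,\pi_2\otimes id\rangle:(A\oplus B)\otimes C\to(A\otimes C)\oplus(B\otimes C)$. Associativity (and permutations of contexts) are left implicit. Interpretation of types: $[\![\mathfrak 1]\!]=I$, $[\![A\multimap B]\!]=[[\![A]\!]\to[\![B]\!]]$, $[\![A\otimes B]\!]=[\![A]\!]\otimes[\![B]\!]$, $[\![\top]\!]=[\![\mathfrak 0]\!]=\mathbf 0$, $[\![A\mathbin{\&}B]\!]=[\![A\oplus B]\!]=[\![A]\!]\oplus[\![B]\!]$, $[\![{!}A]\!]={!}[\![A]\!]$. A context is interpreted as the tensor product of the interpretations of its types ($I$ if empty); ${!}\Upsilon$ replaces each type $A$ in $\Upsilon$ by ${!}A$. For $\Upsilon$ with types $A_1,\dots,A_n$, maps on $\bigotimes_i{!}[\![A_i]\!]$: $e_\Upsilon$ to $I$ ($id_I$ if $n=0$, otherwise the tensor of the $e_{A_i}$ followed by unitors); $d_\Upsilon:[\![{!}\Upsilon]\!]\to[\![{!}\Upsilon]\!]\otimes[\![{!}\Upsilon]\!]$ ($\lambda_I^{-1}$ if $n=0$, otherwise the tensor of the $d_{A_i}$ followed by the symmetry rearranging factors); $\delta_\Upsilon:[\![{!}\Upsilon]\!]\to{!}[\![{!}\Upsilon]\!]$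 ($m_I$ if $n=0$, otherwise the tensor of the $\delta_{A_i}$ followed by the maps $m$). $\overline d_{\Upsilon,\Gamma,\Delta}:[\![{!}\Upsilon]\!]\otimes[\![\Gamma]\!]\otimes[\![\Delta]\!]\to[\![{!}\Upsilon]\!]\otimes[\![\Gamma]\!]\otimes[\![{!}\Upsilon]\!]\otimes[\![\Delta]\!]$ is $d_\Upsilon\otimes id$ followed by the evident symmetry (and unitors inserting $I$ when $\Gamma$ or $\Delta$ is empty). Typing rules and interpretation of $\Upsilon;\Gamma\vdash t:A$ as $[\![t]\!]:[\![{!}\Upsilon]\!]\otimes[\![\Gamma]\!]\to[\![A]\!]$, by induction on derivations: - $\Upsilon;x^A\vdash x:A$: $\lambda\circ(e_\Upsilon\otimes id)$. $\Upsilon,x^A;\varnothing\vdash x:A$: $\lambda\circ(e_\Upsilon\otimes\varepsilon_A)\circ\rho$. - From $\Upsilon;\Gamma\vdash t:A$, $\Upsilon;\Gamma\vdash u:A$ infer $\Upsilon;\Gamma\vdash t\boxplus u:A$: $\nabla\circ([\![t]\!]\oplus[\![u]\!])\circ\Delta$. From $\Upsilon;\Gamma\vdash t:A$ infer $\Upsilon;\Gamma\vdash a\bullet t:A$: $\widehat{(\!|a|\!)}\circ[\![t]\!]$. - $\Upsilon;\varnothing\vdash a.\star:\mathfrak 1$: $(\!|a|\!)\circ e_\Upsilon\circ\rho$. From $\Upsilon;\Gamma\vdash t:\mathfrak 1$, $\Upsilon;\Delta\vdash u:A$ infer $\Upsilon;\Gamma,\Delta\vdash\delta_{\mathfrak 1}(t,u):A$: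 $\lambda\circ([\![t]\!]\otimes[\![u]\!])\circ\overline d_{\Upsilon,\Gamma,\Delta}$. - From $\Upsilon;\Gamma,x^A\vdash t:B$ infer $\Upsilon;\Gamma\vdash\lambda x^A.t:A\multimap B$: $[[\![A]\!]\to[\![t]\!]]\circ\eta_{[\![A]\!]}$. From $\Upsilon;\Gamma\vdash u:A$, $\Upsilon;\Delta\vdash t:A\multimap B$ infer $\Upsilon;\Gamma,\Delta\vdash t\,u:B$: $ev\circ\sigma\circ([\![u]\!]\otimes[\![t]\!])\circ\overline d_{\Upsilon,\Gamma,\Delta}$. - From $\Upsilon;\Gamma\vdash t:A$, $\Upsilon;\Delta\vdash u:B$ infer $\Upsilon;\Gamma,\Delta\vdash t\otimes u:A\otimes B$: $([\![t]\!]\otimes[\![u]\!])\circ\overline d_{\Upsilon,\Gamma,\Delta}$. From $\Upsilon;\Gamma\vdash t:A\otimes B$, $\Upsilon;\Delta,x^A,y^B\vdash u:C$ infer $\Upsilon;\Gamma,\Delta\vdash\delta_\otimes(t,x^Ay^B.u):C$: $[\![u]\!]\circ\sigma\circ([\![t]\!]\otimes id)\circ\overline d_{\Upsilon,\Gamma,\Delta}$. - $\Upsilon;\Gamma\vdash\langle\rangle:\top$: the unique map to $\mathbf 0$. From $\Upsilon;\Gamma\vdash t:\mathfrak 0$ infer $\Upsilon;\Gamma,\Delta\vdash\delta_{\mathfrak 0}(t):C$: $0\circ([\![t]\!]\otimes id_\Delta)$ with $0:\mathbf 0\otimes[\![\Delta]\!]\to[\![C]\!]$ the zero map. - From $\Upsilon;\Gamma\vdash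 t:A$, $\Upsilon;\Gamma\vdash u:B$ infer $\Upsilon;\Gamma\vdash\langle t,u\rangle:A\mathbin{\&}B$: $([\![t]\!]\oplus[\![u]\!])\circ\Delta$. From $\Upsilon;\Gamma\vdash t:A_1\mathbin{\&}A_2$, $\Upsilon;\Delta,x^{A_i}\vdash u:C$ infer $\Upsilon;\Gamma,\Delta\vdash\delta_{\&}^i(t,x^{A_i}.u):C$: $[\![u]\!]\circ\sigma\circ(\pi_i\otimes id)\circ([\![t]\!]\otimes id)\circ\overline d_{\Upsilon,\Gamma,\Delta}$. - From $\Upsilon;\Gamma\vdash t:A$ (resp. $t:B$) infer $\Upsilon;\Gamma\vdash\mathit{inl}(t):A\oplus B$ (resp. $\mathit{inr}(t):A\oplus B$): $i_1\circ[\![t]\!]$ (resp. $i_2\circ[\![t]\!]$). From $\Upsilon;\Gamma\vdash t:A\oplus B$, $\Upsilon;\Delta,x^A\vdash u:C$, $\Upsilon;\Delta,y^B\vdash v:C$ infer $\Upsilon;\Gamma,\Delta\vdash\delta_\oplus(t,x^A.u,y^B.v):C$: $[[\![u]\!],[\![v]\!]]\circ(\sigma\oplus\sigma)\circ dist\circ([\![t]\!]\otimes id)\circ\overline d_{\Upsilon,\Gamma,\Delta}$. - From $\Upsilon;\varnothing\vdash t:A$ infer $\Upsilon;\varnothing\vdash{!}t:{!}A$: ${!}[\![t]\!]\circ{!}(\rho^{-1})\circ\delta_\Upsilon\circ\rho$. From $\Upsilon;\Gamma\vdash t:{!}A$, $\Upsilon,x^A;\Delta\vdash u:B$ infer $\Upsilon;\Gamma,\Delta\vdash\delta_!(t,x^A.u):B$: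 $[\![u]\!]\circ(\sigma\otimes id)\circ([\![t]\!]\otimes id)\circ\overline d_{\Upsilon,\Gamma,\Delta}$. *)

(* Defs.v *)
From mathcomp Require Import all_boot ssralg.
From Stdlib Require Import Relation_Operators.

Set Implicit Arguments.
Unset Strict Implicit.
Unset Printing Implicit Defensive.

Import GRing.Theory.

Record category := Category {
  ob :> Type;
  hom : ob -> ob -> Type;
  idc : forall A, hom A A;
  compc : forall A B C, hom B C -> hom A B -> hom A C;
  comp_idl : forall A B (f : hom A B), compc (idc B) f = f;
  comp_idr : forall A B (f : hom A B), compc f (idc A) = f;
  comp_assoc : forall A B C D (h : hom C D) (g : hom B C) (f : hom A B),
    compc h (compc g f) = compc (compc h g) f }.

Arguments hom {c} A B.
Arguments idc {c} A.
Arguments compc {c A B C} g f.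

Declare Scope cat_scope.
Delimit Scope cat_scope with cat.
Local Open Scope cat_scope.

Notation "g ∘ f" := (compc g f) (at level 40, left associativity) : cat_scope.

(* alpha, lam, rho are the associator and the left and right unitors, with   *)
(* inverses alphaV, lamV, rhoV; sigma is the symmetry.                       *)
Record sym_mon_category := SymMonCategory {
  smc_cat :> category;
  Iob : smc_cat;
  tens : smc_cat -> smc_cat -> smc_cat;
  tensm : forall A B A' B' : smc_cat,
    hom A A' -> hom B B' -> hom (tens A B) (tens A' B');
  alpha : forall A B C, hom (tens (tens A B) C) (tens A (tens B C));
  alphaV : forall A B C, hom (tens A (tens B C)) (tens (tens A B) C);
  lam : forall A, hom (tens Iob A) A;
  lamV : forall A, hom A (tens Iob A);
  rho : forall A, hom (tens A Iob) A;
  rhoV : forall A, hom A (tens A Iob);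
  sigma : forall A B, hom (tens A B) (tens B A);
  tensm_id : forall A B, tensm (idc A) (idc B) = idc (tens A B);
  tensm_comp : forall A B A' B' A'' B''
      (f' : hom A' A'') (f : hom A A') (g' : hom B' B'') (g : hom B B'),
    tensm (f' ∘ f) (g' ∘ g) = tensm f' g' ∘ tensm f g;
  alpha_nat : forall A B C A' B' C'
      (f : hom A A') (g : hom B B') (h : hom C C'),
    alpha A' B' C' ∘ tensm (tensm f g) h
    = tensm f (tensm g h) ∘ alpha A B C;
  lam_nat : forall A A' (f : hom A A'),
    lam A' ∘ tensm (idc Iob) f = f ∘ lam A;
  rho_nat : forall A A' (f : hom A A'),
    rho A' ∘ tensm f (idc Iob) = f ∘ rho A;
  sigma_nat : forall A B A' B' (f : hom A A') (g : hom B B'),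
    sigma A' B' ∘ tensm f g = tensm g f ∘ sigma A B;
  alphaK : forall A B C, alphaV A B C ∘ alpha A B C = idc _;
  alphaVK : forall A B C, alpha A B C ∘ alphaV A B C = idc _;
  lamK : forall A, lamV A ∘ lam A = idc _;
  lamVK : forall A, lam A ∘ lamV A = idc _;
  rhoK : forall A, rhoV A ∘ rho A = idc _;
  rhoVK : forall A, rho A ∘ rhoV A = idc _;
  sigmaK : forall A B, sigma B A ∘ sigma A B = idc _;
  pentagon : forall A B C D,
    alpha A B (tens C D) ∘ alpha (tens A B) C D
    = tensm (idc A) (alpha B C D) ∘ alpha A (tens B C) D
      ∘ tensm (alpha A B C) (idc D);
  triangle : forall A B,
    tensm (idc A) (lam B) ∘ alpha A Iob B = tensm (rho A) (idc B);
  hexagon : forall A B C,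
    alpha B C A ∘ sigma A (tens B C) ∘ alpha A B C
    = tensm (idc B) (sigma A C) ∘ alpha B A C ∘ tensm (sigma A B) (idc C) }.

Arguments Iob {s}.
Arguments tens {s} A B.
Arguments tensm {s A B A' B'} f g.
Arguments alpha {s} A B C.
Arguments alphaV {s} A B C.
Arguments lam {s} A.
Arguments lamV {s} A.
Arguments rho {s} A.
Arguments rhoV {s} A.
Arguments sigma {s} A B.

Notation "A ⊗ B" := (tens A B) (at level 38, left associativity) : cat_scope.
Notation "f ⊗₁ g" := (tensm f g) (at level 38, left associativity) : cat_scope.

Section Interchange.
Context {C : sym_mon_category}.
Implicit Types A B X Y : C.

Definition swap_mid A B X Y : hom ((A ⊗ B) ⊗ (X ⊗ Y)) ((A ⊗ X) ⊗ (B ⊗ Y)) :=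
  alphaV A X (B ⊗ Y)
  ∘ (idc A ⊗₁ (alpha X B Y ∘ (sigma B X ⊗₁ idc Y) ∘ alphaV B X Y))
  ∘ alpha A B (X ⊗ Y).

End Interchange.

(* Closed structure: - ⊗ A is left adjoint to ihom A = [A -> -], with unit   *)
(* eta and counit ev.                                                        *)
Record sym_mon_closed_category := SymMonClosedCategory {
  smcc_smc :> sym_mon_category;
  ihom : smcc_smc -> smcc_smc -> smcc_smc;
  ihomm : forall A B B' : smcc_smc, hom B B' -> hom (ihom A B) (ihom A B');
  eta : forall A X, hom X (ihom A (X ⊗ A));
  ev : forall A B, hom (ihom A B ⊗ A) B;
  ihomm_id : forall A B, ihomm A (idc B) = idc (ihom A B);
  ihomm_comp : forall A B B' B'' (g : hom B' B'') (f : hom B B'),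
    ihomm A (g ∘ f) = ihomm A g ∘ ihomm A f;
  eta_nat : forall A X Y (f : hom X Y),
    ihomm A (f ⊗₁ idc A) ∘ eta A X = eta A Y ∘ f;
  ev_nat : forall A B B' (f : hom B B'),
    ev A B' ∘ (ihomm A f ⊗₁ idc A) = f ∘ ev A B;
  eta_ev : forall A X, ev A (X ⊗ A) ∘ (eta A X ⊗₁ idc A) = idc (X ⊗ A);
  ev_eta : forall A B, ihomm A (ev A B) ∘ eta A (ihom A B) = idc (ihom A B) }.

Arguments ihom {s} A B.
Arguments ihomm {s} A {B B'} f.
Arguments eta {s} A X.
Arguments ev {s} A B.

(* oplus A B is both a product and a coproduct of A and B, and zob is both   *)
(* terminal and initial.                                                     *)
Record biproducts (C : category) := Biproducts {
  zob : C;
  to_zob : forall A, hom A zob;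
  from_zob : forall A, hom zob A;
  oplus : C -> C -> C;
  pi1 : forall A B, hom (oplus A B) A;
  pi2 : forall A B, hom (oplus A B) B;
  bpair : forall X A B, hom X A -> hom X B -> hom X (oplus A B);
  in1 : forall A B, hom A (oplus A B);
  in2 : forall A B, hom B (oplus A B);
  bcopair : forall A B X, hom A X -> hom B X -> hom (oplus A B) X;
  to_zob_uniq : forall A (f : hom A zob), f = to_zob A;
  from_zob_uniq : forall A (f : hom zob A), f = from_zob A;
  pair_pi1 : forall X A B (f : hom X A) (g : hom X B),
    pi1 A B ∘ bpair f g = f;
  pair_pi2 : forall X A B (f : hom X A) (g : hom X B),
    pi2 A B ∘ bpair f g = g;
  pair_uniq : forall X A B (h : hom X (oplus A B)),
    h = bpair (pi1 A B ∘ h) (pi2 A B ∘ h);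
  copair_in1 : forall A B X (f : hom A X) (g : hom B X),
    bcopair f g ∘ in1 A B = f;
  copair_in2 : forall A B X (f : hom A X) (g : hom B X),
    bcopair f g ∘ in2 A B = g;
  copair_uniq : forall A B X (h : hom (oplus A B) X),
    h = bcopair (h ∘ in1 A B) (h ∘ in2 A B);
  pi1_in1 : forall A B, pi1 A B ∘ in1 A B = idc A;
  pi2_in2 : forall A B, pi2 A B ∘ in2 A B = idc B;
  pi2_in1 : forall A B, pi2 A B ∘ in1 A B = from_zob B ∘ to_zob A;
  pi1_in2 : forall A B, pi1 A B ∘ in2 A B = from_zob A ∘ to_zob B }.

(* bang and bangm are ! on objects and maps, eps and dlt the counit and the  *)
(* comultiplication, mT and mI the lax monoidal structure maps of !; the     *)
(* last four laws state that eps and dlt are monoidal.                       *)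
Record sym_mon_comonad (C : sym_mon_category) := SymMonComonad {
  bang : C -> C;
  bangm : forall A B : C, hom A B -> hom (bang A) (bang B);
  eps : forall A, hom (bang A) A;
  dlt : forall A, hom (bang A) (bang (bang A));
  mT : forall A B, hom (bang A ⊗ bang B) (bang (A ⊗ B));
  mI : hom Iob (bang Iob);
  bangm_id : forall A, bangm (idc A) = idc (bang A);
  bangm_comp : forall A B B' (g : hom B B') (f : hom A B),
    bangm (g ∘ f) = bangm g ∘ bangm f;
  eps_nat : forall A B (f : hom A B), eps B ∘ bangm f = f ∘ eps A;
  dlt_nat : forall A B (f : hom A B),
    dlt B ∘ bangm f = bangm (bangm f) ∘ dlt A;
  dlt_epsl : forall A, eps (bang A) ∘ dlt A = idc (bang A);
  dlt_epsr : forall A, bangm (eps A) ∘ dlt A = idc (bang A);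
  dlt_coassoc : forall A, dlt (bang A) ∘ dlt A = bangm (dlt A) ∘ dlt A;
  mT_nat : forall A B A' B' (f : hom A A') (g : hom B B'),
    mT A' B' ∘ (bangm f ⊗₁ bangm g) = bangm (f ⊗₁ g) ∘ mT A B;
  mT_alpha : forall A B D,
    bangm (alpha A B D) ∘ mT (A ⊗ B) D ∘ (mT A B ⊗₁ idc (bang D))
    = mT A (B ⊗ D) ∘ (idc (bang A) ⊗₁ mT B D)
      ∘ alpha (bang A) (bang B) (bang D);
  mT_lam : forall A,
    bangm (lam A) ∘ mT Iob A ∘ (mI ⊗₁ idc (bang A)) = lam (bang A);
  mT_rho : forall A,
    bangm (rho A) ∘ mT A Iob ∘ (idc (bang A) ⊗₁ mI) = rho (bang A);
  mT_sigma : forall A B,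
    bangm (sigma A B) ∘ mT A B = mT B A ∘ sigma (bang A) (bang B);
  eps_mT : forall A B, eps (A ⊗ B) ∘ mT A B = eps A ⊗₁ eps B;
  eps_mI : eps Iob ∘ mI = idc Iob;
  dlt_mT : forall A B,
    dlt (A ⊗ B) ∘ mT A B
    = bangm (mT A B) ∘ mT (bang A) (bang B) ∘ (dlt A ⊗₁ dlt B);
  dlt_mI : dlt Iob ∘ mI = bangm mI ∘ mI }.

Arguments bang {C} s A.
Arguments bangm {C} s {A B} f.
Arguments eps {C} s A.
Arguments dlt {C} s A.
Arguments mT {C} s A B.
Arguments mI {C} s.

Section ComonoidsCoalgebras.
Context {C : sym_mon_category}.
Implicit Types A B : C.

Definition is_comm_comonoid A (d : hom A (A ⊗ A)) (e : hom A Iob) : Prop :=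
  [/\ alpha A A A ∘ (d ⊗₁ idc A) ∘ d = (idc A ⊗₁ d) ∘ d,
      lam A ∘ (e ⊗₁ idc A) ∘ d = idc A,
      rho A ∘ (idc A ⊗₁ e) ∘ d = idc A
    & sigma A A ∘ d = d].

Definition is_comonoid_morphism A (dA : hom A (A ⊗ A)) (eA : hom A Iob)
    B (dB : hom B (B ⊗ B)) (eB : hom B Iob) (f : hom A B) : Prop :=
  dB ∘ f = (f ⊗₁ f) ∘ dA /\ eB ∘ f = eA.

Variable T : sym_mon_comonad C.

Definition is_coalgebra A (h : hom A (bang T A)) : Prop :=
  dlt T A ∘ h = bangm T h ∘ h /\ eps T A ∘ h = idc A.

Definition is_coalgebra_morphism A (hA : hom A (bang T A))
    B (hB : hom B (bang T B)) (f : hom A B) : Prop :=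
  [/\ is_coalgebra hA, is_coalgebra hB & bangm T f ∘ hA = hB ∘ f].

End ComonoidsCoalgebras.

(* The finite products and finite coproducts of a linear category are here   *)
(* both given by biproducts.  The monoidality of ee is relative to the       *)
(* constant functor Iob, with structure maps lam Iob and idc Iob, and that   *)
(* of dd is relative to A |-> !A ⊗ !A, with structure maps                   *)
(* (mT ⊗₁ mT) ∘ swap_mid and (mI ⊗₁ mI) ∘ lamV Iob.                          *)
Record linear_category := LinearCategory {
  lin_cat :> sym_mon_closed_category;
  bip : biproducts lin_cat;
  oc : sym_mon_comonad lin_cat;
  ee : forall A : lin_cat, hom (bang oc A) Iob;
  dd : forall A : lin_cat, hom (bang oc A) (bang oc A ⊗ bang oc A);
  ee_nat : forall A B (f : hom A B), ee B ∘ bangm oc f = ee A;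
  dd_nat : forall A B (f : hom A B),
    dd B ∘ bangm oc f = (bangm oc f ⊗₁ bangm oc f) ∘ dd A;
  ee_mT : forall A B, ee (A ⊗ B) ∘ mT oc A B = lam Iob ∘ (ee A ⊗₁ ee B);
  ee_mI : ee Iob ∘ mI oc = idc Iob;
  dd_mT : forall A B,
    dd (A ⊗ B) ∘ mT oc A B
    = (mT oc A B ⊗₁ mT oc A B)
      ∘ swap_mid (bang oc A) (bang oc A) (bang oc B) (bang oc B)
      ∘ (dd A ⊗₁ dd B);
  dd_mI : dd Iob ∘ mI oc = (mI oc ⊗₁ mI oc) ∘ lamV Iob;
  bang_comonoid : forall A, is_comm_comonoid (dd A) (ee A);
  ee_coalg : forall A,
    is_coalgebra_morphism (T := oc) (dlt oc A) (mI oc) (ee A);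
  dd_coalg : forall A,
    is_coalgebra_morphism (T := oc) (dlt oc A)
      (mT oc (bang oc A) (bang oc A) ∘ (dlt oc A ⊗₁ dlt oc A)) (dd A);
  coalg_comonoid : forall A B (f : hom (bang oc A) (bang oc B)),
    is_coalgebra_morphism (T := oc) (dlt oc A) (dlt oc B) f ->
    is_comonoid_morphism (dd A) (ee A) (dd B) (ee B) f }.

Arguments ee {l} A.
Arguments dd {l} A.

Section BiproductOperations.
Context {C : linear_category}.
Implicit Types A B X : C.

Definition zero_ob : C := zob (bip C).
Definition osum A B : C := oplus (bip C) A B.
Definition prj1 A B : hom (osum A B) A := pi1 (bip C) A B.
Definition prj2 A B : hom (osum A B) B := pi2 (bip C) A B.
Definition inj1 A B : hom A (osum A B) := in1 (bip C) A B.
Definition inj2 A B : hom B (osum A B) := in2 (bip C) A B.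
Definition pairing X A B (f : hom X A) (g : hom X B) : hom X (osum A B) :=
  bpair (bip C) f g.
Definition copairing A B X (f : hom A X) (g : hom B X) : hom (osum A B) X :=
  bcopair (bip C) f g.
Definition bang_ob A : C := bang (oc C) A.

Definition zero_map A B : hom A B := from_zob (bip C) B ∘ to_zob (bip C) A.

Definition osumm A B A' B' (f : hom A A') (g : hom B B') :
    hom (osum A B) (osum A' B') :=
  pairing (f ∘ prj1 A B) (g ∘ prj2 A B).

Definition diag A : hom A (osum A A) := pairing (idc A) (idc A).
Definition codiag A : hom (osum A A) A := copairing (idc A) (idc A).

Definition addm A B (f g : hom A B) : hom A B :=
  codiag B ∘ osumm f g ∘ diag A.

Definition dist A B X : hom (osum A B ⊗ X) (osum (A ⊗ X) (B ⊗ X)) :=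
  pairing (prj1 A B ⊗₁ idc X) (prj2 A B ⊗₁ idc X).

Definition hat (a : hom (Iob : C) Iob) A : hom A A :=
  rho A ∘ (idc A ⊗₁ a) ∘ rhoV A.

End BiproductOperations.

Definition semiring_monomorphism (S : comPzSemiRingType) (C : linear_category)
    (scal : S -> hom (Iob : C) Iob) : Prop :=
  [/\ injective scal,
      scal 0%R = zero_map Iob Iob /\ (forall a b, scal (a + b)%R = addm (scal a) (scal b)),
      scal 1%R = idc Iob
    & forall a b, scal (a * b)%R = scal a ∘ scal b].

Inductive ty :=
| One
| Lolli of ty & ty
| Tensor of ty & ty
| Top
| Zero
| With of ty & ty
| Plus of ty & ty
| Bang of ty.

Fixpoint ty_size (A : ty) : nat :=
  match A with
  | One | Top | Zero => 1
  | Lolli B C | Tensor B C | With B C | Plus B C => ty_size B + ty_size C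
  | Bang B => (ty_size B).+1
  end.

(* Terms modulo alpha-equivalence, with de Bruijn indices.  In               *)
(* let_tens t A B u, i.e. delta_⊗(t, x^A y^B.u), the index 1 of u is x and   *)
(* the index 0 is y.                                                         *)
Inductive tm (S : Type) :=
| var of nat
| sup of tm S & tm S                        (* t ⊞ u *)
| scale of S & tm S                         (* a • t *)
| star of S                                 (* a.⋆ *)
| let_one of tm S & tm S                    (* δ_1(t, u) *)
| lamt of ty & tm S                         (* λx^A.t *)
| app of tm S & tm S
| tenst of tm S & tm S                      (* t ⊗ u *)
| let_tens of tm S & ty & ty & tm S         (* δ_⊗(t, x^A y^B.u) *)
| unitt                                     (* ⟨⟩ *)
| abort of tm S                             (* δ_0(t) *)
| pairt of tm S & tm S                      (* ⟨t, u⟩ *)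
| let_fst of tm S & ty & tm S               (* δ_&^1(t, x^A.u) *)
| let_snd of tm S & ty & tm S               (* δ_&^2(t, x^B.u) *)
| inlt of tm S
| inrt of tm S
| case_plus of tm S & ty & tm S & ty & tm S (* δ_⊕(t, x^A.u, y^B.v) *)
| bangt of tm S                             (* !t *)
| let_bang of tm S & ty & tm S.             (* δ_!(t, x^A.u) *)

Arguments var {S} _.
Arguments unitt {S}.

Section Reduction.
Context {S : comPzSemiRingType}.
Implicit Types (a b : S) (t u v w : tm S) (A B : ty) (x : nat).

Definition up_ren (r : nat -> nat) (x : nat) : nat :=
  if x is y.+1 then (r y).+1 else 0.

Fixpoint rename (r : nat -> nat) t : tm S :=
  match t with
  | var x => var (r x)
  | sup t u => sup (rename r t) (rename r u)
  | scale a t => scale a (rename r t)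
  | star a => star a
  | let_one t u => let_one (rename r t) (rename r u)
  | lamt A t => lamt A (rename (up_ren r) t)
  | app t u => app (rename r t) (rename r u)
  | tenst t u => tenst (rename r t) (rename r u)
  | let_tens t A B u =>
      let_tens (rename r t) A B (rename (up_ren (up_ren r)) u)
  | unitt => unitt
  | abort t => abort (rename r t)
  | pairt t u => pairt (rename r t) (rename r u)
  | let_fst t A u => let_fst (rename r t) A (rename (up_ren r) u)
  | let_snd t B u => let_snd (rename r t) B (rename (up_ren r) u)
  | inlt t => inlt (rename r t)
  | inrt t => inrt (rename r t)
  | case_plus t A u B v =>
      case_plus (rename r t) A (rename (up_ren r) u) B (rename (up_ren r) v)
  | bangt t => bangt (rename r t)
  | let_bang t A u => let_bang (rename r t) A (rename (up_ren r) u)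
  end.

Definition up_sub (s : nat -> tm S) (x : nat) : tm S :=
  if x is y.+1 then rename succn (s y) else var 0.

Fixpoint subst (s : nat -> tm S) t : tm S :=
  match t with
  | var x => s x
  | sup t u => sup (subst s t) (subst s u)
  | scale a t => scale a (subst s t)
  | star a => star a
  | let_one t u => let_one (subst s t) (subst s u)
  | lamt A t => lamt A (subst (up_sub s) t)
  | app t u => app (subst s t) (subst s u)
  | tenst t u => tenst (subst s t) (subst s u)
  | let_tens t A B u =>
      let_tens (subst s t) A B (subst (up_sub (up_sub s)) u)
  | unitt => unitt
  | abort t => abort (subst s t)
  | pairt t u => pairt (subst s t) (subst s u)
  | let_fst t A u => let_fst (subst s t) A (subst (up_sub s) u)
  | let_snd t B u => let_snd (subst s t) B (subst (up_sub s) u)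
  | inlt t => inlt (subst s t)
  | inrt t => inrt (subst s t)
  | case_plus t A u B v =>
      case_plus (subst s t) A (subst (up_sub s) u) B (subst (up_sub s) v)
  | bangt t => bangt (subst s t)
  | let_bang t A u => let_bang (subst s t) A (subst (up_sub s) u)
  end.

Definition scons u (s : nat -> tm S) (x : nat) : tm S :=
  if x is y.+1 then s y else u.

(* (u/x)t, where x is the index 0 of t.                                      *)
Definition subst1 u t : tm S := subst (scons u var) t.

(* (u/x, v/y)t, where x and y are the indices 1 and 0 of t.                  *)
Definition subst2 u v t : tm S := subst (scons v (scons u var)) t.

Inductive head_step : tm S -> tm S -> Prop :=
| h_one a t : head_step (let_one (star a) t) (scale a t)
| h_beta A t u : head_step (app (lamt A t) u) (subst1 u t)
| h_tens u v A B w :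
    head_step (let_tens (tenst u v) A B w) (subst2 u v w)
| h_fst t1 t2 A v : head_step (let_fst (pairt t1 t2) A v) (subst1 t1 v)
| h_snd t1 t2 B v : head_step (let_snd (pairt t1 t2) B v) (subst1 t2 v)
| h_inl t A v B w : head_step (case_plus (inlt t) A v B w) (subst1 t v)
| h_inr u A v B w : head_step (case_plus (inrt u) A v B w) (subst1 u w)
| h_bang t A u : head_step (let_bang (bangt t) A u) (subst1 t u)
| h_sup_star a b : head_step (sup (star a) (star b)) (star (a + b)%R)
| h_sup_lam A t u :
    head_step (sup (lamt A t) (lamt A u)) (lamt A (sup t u))
| h_sup_tens t u A B v :
    head_step (let_tens (sup t u) A B v)
              (sup (let_tens t A B v) (let_tens u A B v))
| h_sup_unit : head_step (sup unitt unitt) unitt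
| h_sup_pair t u v w :
    head_step (sup (pairt t u) (pairt v w)) (pairt (sup t v) (sup u w))
| h_sup_plus t u A v B w :
    head_step (case_plus (sup t u) A v B w)
              (sup (case_plus t A v B w) (case_plus u A v B w))
| h_sup_bang t u A v :
    head_step (let_bang (sup t u) A v) (sup (let_bang t A v) (let_bang u A v))
| h_scale_star a b : head_step (scale a (star b)) (star (a * b)%R)
| h_scale_lam a A t : head_step (scale a (lamt A t)) (lamt A (scale a t))
| h_scale_tens a t A B v :
    head_step (let_tens (scale a t) A B v) (scale a (let_tens t A B v))
| h_scale_unit a : head_step (scale a unitt) unitt
| h_scale_pair a t u :
    head_step (scale a (pairt t u)) (pairt (scale a t) (scale a u))
| h_scale_plus a t A v B w :
    head_step (case_plus (scale a t) A v B w) (scale a (case_plus t A v B w))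
| h_scale_bang a t A v :
    head_step (let_bang (scale a t) A v) (scale a (let_bang t A v)).

Inductive step : tm S -> tm S -> Prop :=
| s_head t t' : head_step t t' -> step t t'
| s_sup_l t t' u : step t t' -> step (sup t u) (sup t' u)
| s_sup_r t u u' : step u u' -> step (sup t u) (sup t u')
| s_scale a t t' : step t t' -> step (scale a t) (scale a t')
| s_let_one_l t t' u : step t t' -> step (let_one t u) (let_one t' u)
| s_let_one_r t u u' : step u u' -> step (let_one t u) (let_one t u')
| s_lamt A t t' : step t t' -> step (lamt A t) (lamt A t')
| s_app_l t t' u : step t t' -> step (app t u) (app t' u)
| s_app_r t u u' : step u u' -> step (app t u) (app t u')
| s_tenst_l t t' u : step t t' -> step (tenst t u) (tenst t' u)
| s_tenst_r t u u' : step u u' -> step (tenst t u) (tenst t u')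
| s_let_tens_l t t' A B u :
    step t t' -> step (let_tens t A B u) (let_tens t' A B u)
| s_let_tens_r t A B u u' :
    step u u' -> step (let_tens t A B u) (let_tens t A B u')
| s_abort t t' : step t t' -> step (abort t) (abort t')
| s_pairt_l t t' u : step t t' -> step (pairt t u) (pairt t' u)
| s_pairt_r t u u' : step u u' -> step (pairt t u) (pairt t u')
| s_let_fst_l t t' A u : step t t' -> step (let_fst t A u) (let_fst t' A u)
| s_let_fst_r t A u u' : step u u' -> step (let_fst t A u) (let_fst t A u')
| s_let_snd_l t t' B u : step t t' -> step (let_snd t B u) (let_snd t' B u)
| s_let_snd_r t B u u' : step u u' -> step (let_snd t B u) (let_snd t B u')
| s_inlt t t' : step t t' -> step (inlt t) (inlt t')
| s_inrt t t' : step t t' -> step (inrt t) (inrt t')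
| s_case_plus t t' A u B v :
    step t t' -> step (case_plus t A u B v) (case_plus t' A u B v)
| s_case_plus_l t A u u' B v :
    step u u' -> step (case_plus t A u B v) (case_plus t A u' B v)
| s_case_plus_r t A u B v v' :
    step v v' -> step (case_plus t A u B v) (case_plus t A u B v')
| s_bangt t t' : step t t' -> step (bangt t) (bangt t')
| s_let_bang_l t t' A u : step t t' -> step (let_bang t A u) (let_bang t' A u)
| s_let_bang_r t A u u' : step u u' -> step (let_bang t A u) (let_bang t A u').

Definition steps : tm S -> tm S -> Prop := clos_refl_trans _ step.

End Reduction.

(* A context, considered up to permutation, is a finite partial map from     *)
(* variables to propositions: the n-th entry is Some A if the variable of    *)
(* index n is declared with proposition A, and None if it is not declared.   *)
(* In a judgement U; G |- t : A a variable bound in t is declared in just    *)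
(* one of U and G, so its entry in the other one is None.                    *)
Definition ctx := seq (option ty).

Inductive Empty : ctx -> Type :=
| empty_nil : Empty [::]
| empty_none G : Empty G -> Empty (None :: G).

(* Single x A G: G is the context x^A.                                       *)
Inductive Single (A : ty) : nat -> ctx -> Type :=
| single_here G : Empty G -> Single A 0 (Some A :: G)
| single_there x G : Single A x G -> Single A x.+1 (None :: G).

(* Merge G D E: E is the (disjoint) context G, D.                            *)
Inductive Merge : ctx -> ctx -> ctx -> Type :=
| merge_nil : Merge [::] [::] [::]
| merge_none G D E : Merge G D E -> Merge (None :: G) (None :: D) (None :: E)
| merge_left A G D E :
    Merge G D E -> Merge (Some A :: G) (None :: D) (Some A :: E)
| merge_right A G D E :
    Merge G D E -> Merge (None :: G) (Some A :: D) (Some A :: E).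

(* typed U G t A is the type of derivations of U; G |- t : A.                *)
Inductive typed {S : Type} : ctx -> ctx -> tm S -> ty -> Type :=
| ty_lvar U G x A :
    Single A x G -> typed U G (var x) A
| ty_ivar U X U' G x A :
    Merge U X U' -> Single A x X -> Empty G -> typed U' G (var x) A
| ty_sup U G t u A :
    typed U G t A -> typed U G u A -> typed U G (sup t u) A
| ty_scale U G a t A :
    typed U G t A -> typed U G (scale a t) A
| ty_star U G a :
    Empty G -> typed U G (star a) One
| ty_let_one U G D E t u A :
    Merge G D E -> typed U G t One -> typed U D u A ->
    typed U E (let_one t u) A
| ty_lamt U G A t B :
    typed (None :: U) (Some A :: G) t B -> typed U G (lamt A t) (Lolli A B)
| ty_app U G D E t u A B :
    Merge G D E -> typed U G u A -> typed U D t (Lolli A B) ->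
    typed U E (app t u) B
| ty_tenst U G D E t u A B :
    Merge G D E -> typed U G t A -> typed U D u B ->
    typed U E (tenst t u) (Tensor A B)
| ty_let_tens U G D E t A B u C :
    Merge G D E -> typed U G t (Tensor A B) ->
    typed (None :: None :: U) (Some B :: Some A :: D) u C ->
    typed U E (let_tens t A B u) C
| ty_unitt U G :
    typed U G unitt Top
| ty_abort U G D E t C :
    Merge G D E -> typed U G t Zero -> typed U E (abort t) C
| ty_pairt U G t u A B :
    typed U G t A -> typed U G u B -> typed U G (pairt t u) (With A B)
| ty_let_fst U G D E t A B u C :
    Merge G D E -> typed U G t (With A B) ->
    typed (None :: U) (Some A :: D) u C ->
    typed U E (let_fst t A u) C
| ty_let_snd U G D E t A B u C :
    Merge G D E -> typed U G t (With A B) ->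
    typed (None :: U) (Some B :: D) u C ->
    typed U E (let_snd t B u) C
| ty_inlt U G t A B :
    typed U G t A -> typed U G (inlt t) (Plus A B)
| ty_inrt U G t A B :
    typed U G t B -> typed U G (inrt t) (Plus A B)
| ty_case_plus U G D E t A u B v C :
    Merge G D E -> typed U G t (Plus A B) ->
    typed (None :: U) (Some A :: D) u C ->
    typed (None :: U) (Some B :: D) v C ->
    typed U E (case_plus t A u B v) C
| ty_bangt U G t A :
    Empty G -> typed U G t A -> typed U G (bangt t) (Bang A)
| ty_let_bang U G D E t A u B :
    Merge G D E -> typed U G t (Bang A) ->
    typed (Some A :: U) (None :: D) u B ->
    typed U E (let_bang t A u) B.

(* The distinguished variable _ is the index 0 of K, which is never under a  *)
(* binder along K; u in el_app and r in el_fst and el_snd are arbitrary      *)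
(* terms.                                                                    *)
Inductive elim_ctx {S : Type} : tm S -> Prop :=
| el_hole : elim_ctx (var 0)
| el_app K u : elim_ctx K -> elim_ctx (app K u)
| el_tens K A B v C :
    elim_ctx K ->
    typed [:: None; None] [:: Some B; Some A] v C ->
    ty_size C < ty_size (Tensor A B) ->
    elim_ctx (let_tens K A B v)
| el_fst K A r : elim_ctx K -> elim_ctx (let_fst K A r)
| el_snd K B r : elim_ctx K -> elim_ctx (let_snd K B r)
| el_plus K A r B s C :
    elim_ctx K ->
    typed [:: None] [:: Some A] r C ->
    typed [:: None] [:: Some B] s C ->
    ty_size C < ty_size (Plus A B) ->
    elim_ctx (case_plus K A r B s)
| el_bang K A r B :
    elim_ctx K ->
    typed [:: Some A] [:: None] r B ->
    ty_size B < ty_size (Bang A) ->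
    elim_ctx (let_bang K A r).

(* _^A |- K : B, with _ in either of the two contexts.                       *)
Definition hole_typed {S : Type} (A : ty) (K : tm S) (B : ty) : Prop :=
  inhabited (typed [:: Some A] [:: None] K B)
  \/ inhabited (typed [:: None] [:: Some A] K B).

Definition fill {S : comPzSemiRingType} (K t : tm S) : tm S := subst1 t K.

Definition obs_equiv {S : comPzSemiRingType} (A : ty) (t r : tm S) : Prop :=
  forall (K : tm S) (a : S),
    elim_ctx K -> hole_typed A K One ->
    (steps (fill K t) (star a) <-> steps (fill K r) (star a)).

Section Interpretation.
Context {C : linear_category}.

Fixpoint ity (A : ty) : C :=
  match A with
  | One => Iob
  | Lolli A B => ihom (ity A) (ity B)
  | Tensor A B => ity A ⊗ ity B
  | Top | Zero => zero_ob
  | With A B | Plus A B => osum (ity A) (ity B)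
  | Bang A => bang_ob (ity A)
  end.

Definition ibang (A : ty) : C := bang_ob (ity A).

(* Contexts are extended at the head, so the head of a list of propositions  *)
(* is its last element in the usual notation, and tensor products of         *)
(* contexts are associated to the left.                                      *)
Fixpoint itens (F : ty -> C) (l : seq ty) : C :=
  match l with
  | [::] => Iob
  | A :: l' => match l' with [::] => F A | _ :: _ => itens F l' ⊗ F A end
  end.

Definition types (G : ctx) : seq ty := pmap id G.

(* ilin G is [[G]] and iint U is [[!U]].                                     *)
Definition ictx (F : ty -> C) (G : ctx) : C := itens F (types G).
Definition ilin (G : ctx) : C := ictx ity G.
Definition iint (U : ctx) : C := ictx ibang U.

(* The isomorphism [[l]] ⊗ [[A]] -> [[l, A]] and its inverse: identities     *)
(* unless l is empty.                                                        *)
Definition snoc F (l : seq ty) A : hom (itens F l ⊗ F A) (itens F (A :: l)) :=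
  match l return hom (itens F l ⊗ F A) (itens F (A :: l)) with
  | [::] => lam (F A)
  | _ :: _ => idc _
  end.

Definition unsnoc F (l : seq ty) A : hom (itens F (A :: l)) (itens F l ⊗ F A) :=
  match l return hom (itens F (A :: l)) (itens F l ⊗ F A) with
  | [::] => lamV (F A)
  | _ :: _ => idc _
  end.

Fixpoint empty_map F G (p : Empty G) : hom (ictx F G) Iob :=
  match p in Empty G return hom (ictx F G) Iob with
  | empty_nil => idc Iob
  | empty_none _ p => empty_map F p
  end.

Fixpoint empty_mapV F G (p : Empty G) : hom Iob (ictx F G) :=
  match p in Empty G return hom Iob (ictx F G) with
  | empty_nil => idc Iob
  | empty_none _ p => empty_mapV F p
  end.

Fixpoint single_map F A x G (p : Single A x G) : hom (ictx F G) (F A) :=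
  match p in Single _ _ G return hom (ictx F G) (F A) with
  | single_here G p =>
      lam (F A) ∘ (empty_map F p ⊗₁ idc (F A)) ∘ unsnoc F (types G) A
  | single_there _ _ p => single_map F p
  end.

(* The evident permutation [[G, D]] -> [[G]] ⊗ [[D]].                        *)
Fixpoint merge_map F G D E (p : Merge G D E) :
    hom (ictx F E) (ictx F G ⊗ ictx F D) :=
  match p in Merge G D E return hom (ictx F E) (ictx F G ⊗ ictx F D) with
  | merge_nil => lamV Iob
  | merge_none _ _ _ p => merge_map F p
  | merge_left A G D E p =>
      (snoc F (types G) A ⊗₁ idc (ictx F D))
      ∘ alphaV (ictx F G) (F A) (ictx F D)
      ∘ (idc (ictx F G) ⊗₁ sigma (ictx F D) (F A))
      ∘ alpha (ictx F G) (ictx F D) (F A)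
      ∘ (merge_map F p ⊗₁ idc (F A))
      ∘ unsnoc F (types E) A
  | merge_right A G D E p =>
      (idc (ictx F G) ⊗₁ snoc F (types D) A)
      ∘ alpha (ictx F G) (ictx F D) (F A)
      ∘ (merge_map F p ⊗₁ idc (F A))
      ∘ unsnoc F (types E) A
  end.

(* e_U, d_U and delta_U on the list of propositions of U.  The case of a     *)
(* single proposition is separate because its interpretation is !A and not   *)
(* I ⊗ !A.                                                                   *)
Fixpoint e_list (l : seq ty) : hom (itens ibang l) Iob :=
  match l with
  | [::] => idc Iob
  | A :: l' =>
      match l' return hom (itens ibang l') Iob -> hom (itens ibang (A :: l')) Iob with
      | [::] => fun _ => ee (ity A)
      | _ :: _ => fun e' => lam Iob ∘ (e' ⊗₁ ee (ity A))
      end (e_list l')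
  end.

Fixpoint d_list (l : seq ty) : hom (itens ibang l) (itens ibang l ⊗ itens ibang l) :=
  match l with
  | [::] => lamV Iob
  | A :: l' =>
      match l' return
          hom (itens ibang l') (itens ibang l' ⊗ itens ibang l') ->
          hom (itens ibang (A :: l')) (itens ibang (A :: l') ⊗ itens ibang (A :: l'))
      with
      | [::] => fun _ => dd (ity A)
      | _ :: _ => fun d' => swap_mid _ _ _ _ ∘ (d' ⊗₁ dd (ity A))
      end (d_list l')
  end.

Fixpoint dlt_list (l : seq ty) : hom (itens ibang l) (bang_ob (itens ibang l)) :=
  match l with
  | [::] => mI (oc C)
  | A :: l' =>
      match l' return
          hom (itens ibang l') (bang_ob (itens ibang l')) ->
          hom (itens ibang (A :: l')) (bang_ob (itens ibang (A :: l')))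
      with
      | [::] => fun _ => dlt (oc C) (ity A)
      | _ :: _ => fun dl' => mT (oc C) _ _ ∘ (dl' ⊗₁ dlt (oc C) (ity A))
      end (dlt_list l')
  end.

Definition e_ctx (U : ctx) : hom (iint U) Iob := e_list (types U).
Definition d_ctx (U : ctx) : hom (iint U) (iint U ⊗ iint U) := d_list (types U).
Definition dlt_ctx (U : ctx) : hom (iint U) (bang_ob (iint U)) :=
  dlt_list (types U).

Definition dbar U G D E (p : Merge G D E) :
    hom (iint U ⊗ ilin E) ((iint U ⊗ ilin G) ⊗ (iint U ⊗ ilin D)) :=
  swap_mid (iint U) (iint U) (ilin G) (ilin D)
  ∘ (d_ctx U ⊗₁ merge_map ity p).

(* ([[!U]] ⊗ [[G]]) ⊗ [[A]] -> [[!U]] ⊗ [[G, A]]                             *)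
Definition ext U G A :
    hom ((iint U ⊗ ilin G) ⊗ ity A) (iint U ⊗ ilin (Some A :: G)) :=
  (idc (iint U) ⊗₁ snoc ity (types G) A) ∘ alpha (iint U) (ilin G) (ity A).

Variable S : comPzSemiRingType.
Variable scal : S -> hom (Iob : C) Iob.

Fixpoint interp U G (t : tm S) A (p : typed U G t A) :
    hom (iint U ⊗ ilin G) (ity A) :=
  match p in typed U G _ A return hom (iint U ⊗ ilin G) (ity A) with
  | ty_lvar U _ _ A q =>
      lam (ity A) ∘ (e_ctx U ⊗₁ single_map ity q)
  | ty_ivar U _ U' _ _ A m q z =>
      lam (ity A)
      ∘ (e_ctx U ⊗₁ (eps (oc C) (ity A) ∘ single_map ibang q))
      ∘ merge_map ibang m
      ∘ rho (iint U') ∘ (idc (iint U') ⊗₁ empty_map ity z)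
  | ty_sup U G _ _ A p1 p2 =>
      codiag (ity A) ∘ osumm (interp p1) (interp p2) ∘ diag (iint U ⊗ ilin G)
  | ty_scale _ _ a _ A p1 =>
      hat (scal a) (ity A) ∘ interp p1
  | ty_star U _ a z =>
      scal a ∘ e_ctx U ∘ rho (iint U) ∘ (idc (iint U) ⊗₁ empty_map ity z)
  | ty_let_one U _ _ _ _ _ A m p1 p2 =>
      lam (ity A) ∘ (interp p1 ⊗₁ interp p2) ∘ dbar U m
  | ty_lamt U G A _ _ p1 =>
      ihomm (ity A) (interp p1 ∘ ext U G A) ∘ eta (ity A) (iint U ⊗ ilin G)
  | ty_app U _ _ _ _ _ A B m p1 p2 =>
      ev (ity A) (ity B) ∘ sigma (ity A) (ihom (ity A) (ity B))
      ∘ (interp p1 ⊗₁ interp p2) ∘ dbar U m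
  | ty_tenst U _ _ _ _ _ _ _ m p1 p2 =>
      (interp p1 ⊗₁ interp p2) ∘ dbar U m
  | ty_let_tens U _ D _ _ A B _ _ m p1 p2 =>
      interp p2
      ∘ ext (None :: U) (Some A :: D) B
      ∘ (ext U D A ⊗₁ idc (ity B))
      ∘ alphaV (iint U ⊗ ilin D) (ity A) (ity B)
      ∘ sigma (ity A ⊗ ity B) (iint U ⊗ ilin D)
      ∘ (interp p1 ⊗₁ idc (iint U ⊗ ilin D)) ∘ dbar U m
  | ty_unitt U G =>
      to_zob (bip C) (iint U ⊗ ilin G)
  | ty_abort U G D _ _ A m p1 =>
      zero_map (zero_ob ⊗ ilin D) (ity A)
      ∘ (interp p1 ⊗₁ idc (ilin D))
      ∘ alphaV (iint U) (ilin G) (ilin D)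
      ∘ (idc (iint U) ⊗₁ merge_map ity m)
  | ty_pairt U G _ _ _ _ p1 p2 =>
      osumm (interp p1) (interp p2) ∘ diag (iint U ⊗ ilin G)
  | ty_let_fst U _ D _ _ A B _ _ m p1 p2 =>
      interp p2 ∘ ext U D A
      ∘ sigma (ity A) (iint U ⊗ ilin D)
      ∘ (prj1 (ity A) (ity B) ⊗₁ idc (iint U ⊗ ilin D))
      ∘ (interp p1 ⊗₁ idc (iint U ⊗ ilin D)) ∘ dbar U m
  | ty_let_snd U _ D _ _ A B _ _ m p1 p2 =>
      interp p2 ∘ ext U D B
      ∘ sigma (ity B) (iint U ⊗ ilin D)
      ∘ (prj2 (ity A) (ity B) ⊗₁ idc (iint U ⊗ ilin D))
      ∘ (interp p1 ⊗₁ idc (iint U ⊗ ilin D)) ∘ dbar U m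
  | ty_inlt _ _ _ A B p1 =>
      inj1 (ity A) (ity B) ∘ interp p1
  | ty_inrt _ _ _ A B p1 =>
      inj2 (ity A) (ity B) ∘ interp p1
  | ty_case_plus U _ D _ _ A _ B _ _ m p1 p2 p3 =>
      copairing (interp p2 ∘ ext U D A) (interp p3 ∘ ext U D B)
      ∘ osumm (sigma (ity A) (iint U ⊗ ilin D))
              (sigma (ity B) (iint U ⊗ ilin D))
      ∘ dist (ity A) (ity B) (iint U ⊗ ilin D)
      ∘ (interp p1 ⊗₁ idc (iint U ⊗ ilin D)) ∘ dbar U m
  | ty_bangt U _ _ _ z p1 =>
      bangm (oc C) (interp p1 ∘ (idc (iint U) ⊗₁ empty_mapV ity z))
      ∘ bangm (oc C) (rhoV (iint U))
      ∘ dlt_ctx U ∘ rho (iint U) ∘ (idc (iint U) ⊗₁ empty_map ity z)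
  | ty_let_bang U _ D _ _ A _ _ m p1 p2 =>
      interp p2
      ∘ (snoc ibang (types U) A ⊗₁ idc (ilin D))
      ∘ (sigma (ibang A) (iint U) ⊗₁ idc (ilin D))
      ∘ alphaV (ibang A) (iint U) (ilin D)
      ∘ (interp p1 ⊗₁ idc (iint U ⊗ ilin D)) ∘ dbar U m
  end.

End Interpretation.

(* Main.v *)
Require Import Defs.
From mathcomp Require Import all_boot ssralg.
From Stdlib Require Import Relation_Operators Operators_Properties.

(** The proof is by a logical relation between terms of type [A] and points
    [I -> [[A]]] of the model, in which a term of a type [A ⊗ B], [A ⊕ B] or
    [!A] has to reduce to a linear combination of introductions.  Every
    derivation of a closed term relates it to its interpretation; at type [1]
    this says that the term reduces to some [a.⋆] with [(|a|)] its
    interpretation.  Any derivation of [K] relates [K[t]] and [K[r]] to the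
    same point, as [t] and [r] are related to the same point.  Hence they
    reduce to the same [a.⋆] by injectivity of [(|.|)], and this is the only
    scalar to which they reduce, by confluence.  Neither subject reduction nor
    independence of the interpretation from the derivation is needed. *)

Set Implicit Arguments.
Unset Strict Implicit.
Unset Printing Implicit Defensive.

Import GRing.Theory.

Local Open Scope cat_scope.

(** * Substitution and parallel reduction *)

Section Substitution.
Context {S : comPzSemiRingType}.
Implicit Types (t u v w : tm S) (r : nat -> nat) (s : nat -> tm S).

(** The basic substitution lemmas relate substitutions pointwise: the induction then passes under
    binders, where the local [up] transports the hypothesis, without equating functions. *)
Lemma subst_rename t r s s' :
  (forall x, s (r x) = s' x) -> subst s (rename r t) = subst s' t.
Proof.
have up r1 s1 s2 : (forall x, s1 (r1 x) = s2 x) ->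
    forall x, up_sub s1 (up_ren r1 x) = up_sub s2 x.
  by move=> e [|x] //=; rewrite e.
by elim: t r s s' => /= *; first [by auto | f_equal; auto].
Qed.

Lemma subst_var t s : (forall x, s x = var x) -> subst s t = t.
Proof.
have up s1 : (forall x, s1 x = var x) -> forall x, up_sub s1 x = var x.
  by move=> e [|x] //=; rewrite e.
by elim: t s => /= *; first [by auto | f_equal; auto].
Qed.

Lemma rename_subst_var t r s : (forall x, s x = var (r x)) ->
  rename r t = subst s t.
Proof.
have up r1 s1 : (forall x, s1 x = var (r1 x)) ->
    forall x, up_sub s1 x = var (up_ren r1 x).
  by move=> e [|x] //=; rewrite e.
by elim: t r s => /= *; first [by auto | f_equal; auto].
Qed.

Lemma rename_rename t r1 r2 r : (forall x, r1 (r2 x) = r x) ->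
  rename r1 (rename r2 t) = rename r t.
Proof.
move=> e; rewrite (@rename_subst_var _ r1 (fun x => var (r1 x))) //.
rewrite (@rename_subst_var t r (fun x => var (r x))) //.
by apply: subst_rename => x; rewrite e.
Qed.

Lemma rename_subst t r s s' :
  (forall x, rename r (s x) = s' x) -> rename r (subst s t) = subst s' t.
Proof.
have up r1 s1 s2 : (forall x, rename r1 (s1 x) = s2 x) ->
    forall x, rename (up_ren r1) (up_sub s1 x) = up_sub s2 x.
  move=> e [|x] //=; rewrite -e.
  rewrite (@rename_rename _ _ _ (fun x => (r1 x).+1)) //.
  by rewrite (@rename_rename _ _ _ (fun x => (r1 x).+1)).
by elim: t r s s' => /= *; first [by auto | f_equal; auto].
Qed.

Lemma subst_subst t s1 s2 s :
  (forall x, subst s1 (s2 x) = s x) -> subst s1 (subst s2 t) = subst s t.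
Proof.
have up s3 s4 s5 : (forall x, subst s3 (s4 x) = s5 x) ->
    forall x, subst (up_sub s3) (up_sub s4 x) = up_sub s5 x.
  move=> e [|x] //=; rewrite -e.
  rewrite (@subst_rename _ _ _ (fun x => rename succn (s3 x))) //.
  by apply/esym/rename_subst.
by elim: t s1 s2 s => /= *; first [by auto | f_equal; auto].
Qed.

Lemma subst_rename_succ u v s : subst (scons u s) (rename succn v) = subst s v.
Proof. exact: subst_rename. Qed.

Lemma subst1_up_sub u t s :
  subst1 u (subst (up_sub s) t) = subst (scons u s) t.
Proof.
apply: subst_subst => -[|x] //=.
by rewrite subst_rename_succ subst_var.
Qed.

Lemma subst2_up_sub u v t s :
  subst2 u v (subst (up_sub (up_sub s)) t) = subst (scons v (scons u s)) t.
Proof.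
apply: subst_subst => -[|[|x]] //=.
by rewrite !subst_rename_succ subst_var.
Qed.

Lemma rename_subst1 u t r :
  rename r (subst1 u t) = subst1 (rename r u) (rename (up_ren r) t).
Proof.
rewrite /subst1 (@rename_subst t r _ (fun x => rename r (scons u var x))) //.
by apply/esym/subst_rename => -[|x].
Qed.

Lemma rename_subst2 u v t r :
  rename r (subst2 u v t)
  = subst2 (rename r u) (rename r v) (rename (up_ren (up_ren r)) t).
Proof.
rewrite /subst2
  (@rename_subst t r _ (fun x => rename r (scons v (scons u var) x))) //.
by apply/esym/subst_rename => -[|[|x]].
Qed.

Lemma subst_subst1 u t s :
  subst s (subst1 u t) = subst1 (subst s u) (subst (up_sub s) t).
Proof. by rewrite subst1_up_sub; apply: subst_subst => -[|x]. Qed.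

Lemma subst_subst2 u v t s :
  subst s (subst2 u v t)
  = subst2 (subst s u) (subst s v) (subst (up_sub (up_sub s)) t).
Proof. by rewrite subst2_up_sub; apply: subst_subst => -[|[|x]]. Qed.

End Substitution.

(** * Confluence through complete developments *)

Section ParallelReduction.
Context {S : comPzSemiRingType}.
Implicit Types (a b : S) (t u v w : tm S) (A B : ty).

(* Reduction is not confluent on ill-typed terms: the argument of an         *)
(* eliminator of ⊗, ⊕ or ! can be a sum (or a multiple) of introductions of  *)
(* other connectives, and then both the sum and the eliminator can reduce.   *)
(* [par] joins such pairs by also reducing an elimination of this kind to    *)
(* [unitt].                                                                  *)
Fixpoint nodata t : bool :=
  match t with
  | star _ | lamt _ _ | unitt | pairt _ _ => true
  | sup t u => nodata t && nodata u
  | scale _ t | let_tens t _ _ _ | case_plus t _ _ _ _ | let_bang t _ _ =>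
      nodata t
  | _ => false
  end.

(** The terms that may collapse to [unitt]: eliminations stuck on a [nodata] argument, [unitt], and
    sums and multiples of these. The reductions of [⟨⟩ ⊞ ⟨⟩] and [a • ⟨⟩] are thus instances of
    [par_junk]. *)
Fixpoint junk t : bool :=
  match t with
  | unitt => true
  | sup t u => junk t && junk u
  | scale _ t => junk t
  | let_tens t _ _ _ | case_plus t _ _ _ _ | let_bang t _ _ => nodata t
  | _ => false
  end.

(* In [par_sup_lam] the two abstractions need not carry the same type, so    *)
(* that the rules are left-linear.                                           *)
Inductive par : tm S -> tm S -> Prop :=
| par_var x : par (var x) (var x)
| par_sup t t' u u' : par t t' -> par u u' -> par (sup t u) (sup t' u')
| par_scale a t t' : par t t' -> par (scale a t) (scale a t')
| par_star a : par (star a) (star a)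
| par_let_one t t' u u' :
    par t t' -> par u u' -> par (let_one t u) (let_one t' u')
| par_lamt A t t' : par t t' -> par (lamt A t) (lamt A t')
| par_app t t' u u' : par t t' -> par u u' -> par (app t u) (app t' u')
| par_tenst t t' u u' : par t t' -> par u u' -> par (tenst t u) (tenst t' u')
| par_let_tens t t' A B u u' :
    par t t' -> par u u' -> par (let_tens t A B u) (let_tens t' A B u')
| par_unitt : par unitt unitt
| par_abort t t' : par t t' -> par (abort t) (abort t')
| par_pairt t t' u u' : par t t' -> par u u' -> par (pairt t u) (pairt t' u')
| par_let_fst t t' A u u' :
    par t t' -> par u u' -> par (let_fst t A u) (let_fst t' A u')
| par_let_snd t t' A u u' :
    par t t' -> par u u' -> par (let_snd t A u) (let_snd t' A u')
| par_inlt t t' : par t t' -> par (inlt t) (inlt t')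
| par_inrt t t' : par t t' -> par (inrt t) (inrt t')
| par_case_plus t t' A u u' B v v' :
    par t t' -> par u u' -> par v v' ->
    par (case_plus t A u B v) (case_plus t' A u' B v')
| par_bangt t t' : par t t' -> par (bangt t) (bangt t')
| par_let_bang t t' A u u' :
    par t t' -> par u u' -> par (let_bang t A u) (let_bang t' A u')
| par_junk t : junk t -> par t unitt
| par_one a t t' : par t t' -> par (let_one (star a) t) (scale a t')
| par_beta A t t' u u' :
    par t t' -> par u u' -> par (app (lamt A t) u) (subst1 u' t')
| par_tens u u' v v' A B w w' :
    par u u' -> par v v' -> par w w' ->
    par (let_tens (tenst u v) A B w) (subst2 u' v' w')
| par_fst t1 t1' t2 A v v' :
    par t1 t1' -> par v v' -> par (let_fst (pairt t1 t2) A v) (subst1 t1' v')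
| par_snd t1 t2 t2' B v v' :
    par t2 t2' -> par v v' -> par (let_snd (pairt t1 t2) B v) (subst1 t2' v')
| par_inl t t' A v v' B w :
    par t t' -> par v v' -> par (case_plus (inlt t) A v B w) (subst1 t' v')
| par_inr t t' A v B w w' :
    par t t' -> par w w' -> par (case_plus (inrt t) A v B w) (subst1 t' w')
| par_bang t t' A u u' :
    par t t' -> par u u' -> par (let_bang (bangt t) A u) (subst1 t' u')
| par_sup_star a b : par (sup (star a) (star b)) (star (a + b)%R)
| par_sup_lam A B t t' u u' :
    par t t' -> par u u' ->
    par (sup (lamt A t) (lamt B u)) (lamt A (sup t' u'))
| par_sup_tens t t' u u' A B v v' :
    par t t' -> par u u' -> par v v' ->
    par (let_tens (sup t u) A B v)
        (sup (let_tens t' A B v') (let_tens u' A B v'))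
| par_sup_pair t t' u u' v v' w w' :
    par t t' -> par u u' -> par v v' -> par w w' ->
    par (sup (pairt t u) (pairt v w)) (pairt (sup t' v') (sup u' w'))
| par_sup_plus t t' u u' A v v' B w w' :
    par t t' -> par u u' -> par v v' -> par w w' ->
    par (case_plus (sup t u) A v B w)
        (sup (case_plus t' A v' B w') (case_plus u' A v' B w'))
| par_sup_bang t t' u u' A v v' :
    par t t' -> par u u' -> par v v' ->
    par (let_bang (sup t u) A v) (sup (let_bang t' A v') (let_bang u' A v'))
| par_scale_star a b : par (scale a (star b)) (star (a * b)%R)
| par_scale_lam a A t t' :
    par t t' -> par (scale a (lamt A t)) (lamt A (scale a t'))
| par_scale_tens a t t' A B v v' :
    par t t' -> par v v' ->
    par (let_tens (scale a t) A B v) (scale a (let_tens t' A B v'))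
| par_scale_pair a t t' u u' :
    par t t' -> par u u' ->
    par (scale a (pairt t u)) (pairt (scale a t') (scale a u'))
| par_scale_plus a t t' A v v' B w w' :
    par t t' -> par v v' -> par w w' ->
    par (case_plus (scale a t) A v B w) (scale a (case_plus t' A v' B w'))
| par_scale_bang a t t' A v v' :
    par t t' -> par v v' ->
    par (let_bang (scale a t) A v) (scale a (let_bang t' A v')).

Hint Constructors par : core.

Lemma par_refl t : par t t.
Proof. by elim: t => * //; constructor. Qed.

Hint Resolve par_refl : core.

Ltac inv_par :=
  repeat match goal with
  | H : is_true (junk _) |- _ => discriminate H
  | H : par ?t _ |- _ =>
      match t with
      | star _ => idtac | lamt _ _ => idtac | unitt => idtac
      | pairt _ _ => idtac | tenst _ _ => idtac | bangt _ => idtac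
      | inlt _ => idtac | inrt _ => idtac
      | sup _ _ => idtac | scale _ _ => idtac
      end; inversion H; clear H; subst
  end.

Lemma step_par t t' : step t t' -> par t t'.
Proof.
by elim; intros; auto;
  match goal with H : head_step _ _ |- _ => case: H end; auto.
Qed.

Lemma junk_nodata t : junk t -> nodata t.
Proof. by elim: t => //= t IHt u IHu /andP[/IHt-> /IHu]. Qed.

Lemma nodata_subst s t : nodata t -> nodata (subst s t).
Proof. by elim: t s => //= t IHt u IHu s /andP[/IHt-> /IHu->]. Qed.

Lemma junk_subst s t : junk t -> junk (subst s t).
Proof.
elim: t s => //=; try by move=> *; apply: nodata_subst.
by move=> t IHt u IHu s /andP[/IHt-> /IHu->].
Qed.

Lemma junk_rename r t : junk t -> junk (rename r t).
Proof. by rewrite (@rename_subst_var _ t r _ (fun=> erefl)) => /junk_subst. Qed.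

Hint Resolve junk_rename junk_subst : core.

(** No introduction of ⊗, ⊕ or ! is [nodata], so an elimination that is [nodata] can commute with ⊞
    or •, or collapse, but never fires on an introduction. *)
Lemma par_nodata t t' : par t t' -> nodata t -> nodata t'.
Proof.
elim=> //= {t t'}; try by move=> t t' u u' _ IHt _ IHu /andP[/IHt-> /IHu->].
- by move=> t t' u u' A B v v' _ IHt _ IHu _ _ /andP[/IHt-> /IHu->].
- by move=> t t' u u' A v v' B w w' _ IHt _ IHu _ _ _ _ /andP[/IHt-> /IHu->].
- by move=> t t' u u' A v v' _ IHt _ IHu _ _ /andP[/IHt-> /IHu->].
Qed.

Lemma junk_par t t' : par t t' -> junk t -> junk t'.
Proof.
elim=> //= {t t'}; try by move=> *; apply: par_nodata; eauto.
- by move=> t t' u u' _ IHt _ IHu /andP[/IHt-> /IHu->].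
- move=> t t' u u' A B v v' pt _ pu _ _ _ /andP[nt nu].
  by rewrite (par_nodata pt) ?(par_nodata pu).
- move=> t t' u u' A v v' B w w' pt _ pu _ _ _ _ _ /andP[nt nu].
  by rewrite (par_nodata pt) ?(par_nodata pu).
- move=> t t' u u' A v v' pt _ pu _ _ _ /andP[nt nu].
  by rewrite (par_nodata pt) ?(par_nodata pu).
Qed.

Lemma par_rename r t t' : par t t' -> par (rename r t) (rename r t').
Proof.
move=> p; elim: p r => /= *; rewrite ?rename_subst1 ?rename_subst2; auto.
Qed.

Lemma par_subst t t' s s' :
  par t t' -> (forall x, par (s x) (s' x)) -> par (subst s t) (subst s' t').
Proof.
have up s1 s2 : (forall x, par (s1 x) (s2 x)) ->
    forall x, par (up_sub s1 x) (up_sub s2 x).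
  by move=> e [|x] //=; apply: par_rename.
move=> p; elim: p s s' => /= *; rewrite ?subst_subst1 ?subst_subst2; auto 6.
Qed.

Lemma par_subst1 t t' u u' :
  par t t' -> par u u' -> par (subst1 u t) (subst1 u' t').
Proof. by move=> pt pu; apply: par_subst => // -[|x]. Qed.

Lemma par_subst2 t t' u u' v v' :
  par t t' -> par u u' -> par v v' -> par (subst2 u v t) (subst2 u' v' t').
Proof. by move=> pt pu pv; apply: par_subst => // -[|[|x]]. Qed.

(** Takahashi's complete development: all visible redexes are contracted at once. The collapse of
    [junk] takes precedence over every other rule. *)
Fixpoint develop t : tm S :=
  if junk t then unitt else
  match t with
  | var x => var x
  | sup t u =>
      match t, u with
      | star a, star b => star (a + b)%R
      | lamt A t1, lamt _ u1 => lamt A (sup (develop t1) (develop u1))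
      | pairt t1 t2, pairt u1 u2 =>
          pairt (sup (develop t1) (develop u1)) (sup (develop t2) (develop u2))
      | _, _ => sup (develop t) (develop u)
      end
  | scale a t =>
      match t with
      | star b => star (a * b)%R
      | lamt A t1 => lamt A (scale a (develop t1))
      | pairt t1 t2 => pairt (scale a (develop t1)) (scale a (develop t2))
      | _ => scale a (develop t)
      end
  | star a => star a
  | let_one t u =>
      match t with
      | star a => scale a (develop u)
      | _ => let_one (develop t) (develop u)
      end
  | lamt A t => lamt A (develop t)
  | app t u =>
      match t with
      | lamt _ t1 => subst1 (develop u) (develop t1)
      | _ => app (develop t) (develop u)
      end
  | tenst t u => tenst (develop t) (develop u)
  | let_tens t A B u =>
      match t with
      | tenst t1 t2 => subst2 (develop t1) (develop t2) (develop u)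
      | sup t1 t2 => sup (let_tens (develop t1) A B (develop u))
                         (let_tens (develop t2) A B (develop u))
      | scale a t1 => scale a (let_tens (develop t1) A B (develop u))
      | _ => let_tens (develop t) A B (develop u)
      end
  | unitt => unitt
  | abort t => abort (develop t)
  | pairt t u => pairt (develop t) (develop u)
  | let_fst t A u =>
      match t with
      | pairt t1 _ => subst1 (develop t1) (develop u)
      | _ => let_fst (develop t) A (develop u)
      end
  | let_snd t B u =>
      match t with
      | pairt _ t2 => subst1 (develop t2) (develop u)
      | _ => let_snd (develop t) B (develop u)
      end
  | inlt t => inlt (develop t)
  | inrt t => inrt (develop t)
  | case_plus t A u B v =>
      match t with
      | inlt t1 => subst1 (develop t1) (develop u)
      | inrt t1 => subst1 (develop t1) (develop v)
      | sup t1 t2 => sup (case_plus (develop t1) A (develop u) B (develop v))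
                         (case_plus (develop t2) A (develop u) B (develop v))
      | scale a t1 =>
          scale a (case_plus (develop t1) A (develop u) B (develop v))
      | _ => case_plus (develop t) A (develop u) B (develop v)
      end
  | bangt t => bangt (develop t)
  | let_bang t A u =>
      match t with
      | bangt t1 => subst1 (develop t1) (develop u)
      | sup t1 t2 => sup (let_bang (develop t1) A (develop u))
                         (let_bang (develop t2) A (develop u))
      | scale a t1 => scale a (let_bang (develop t1) A (develop u))
      | _ => let_bang (develop t) A (develop u)
      end
  end.

(** A sum that is not [nodata] is not [junk], and its sides are not both scalars, both abstractions
    or both pairs; hence the sum is not itself contracted. *)
Lemma develop_sup t u :
  nodata (sup t u) = false ->
  develop (sup t u) = sup (develop t) (develop u).
Proof.
move=> n; have -> /= : develop (sup t u) =
    match t, u with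
    | star a, star b => star (a + b)%R
    | lamt A t1, lamt _ u1 => lamt A (sup (develop t1) (develop u1))
    | pairt t1 t2, pairt u1 u2 =>
        pairt (sup (develop t1) (develop u1)) (sup (develop t2) (develop u2))
    | _, _ => sup (develop t) (develop u)
    end.
  by rewrite /=; case: ifP => // /(@junk_nodata (sup t u)); rewrite n.
by case: t n => //; case: u.
Qed.

Lemma develop_scale a t :
  nodata (scale a t) = false -> develop (scale a t) = scale a (develop t).
Proof.
move=> /= n; case: ifP => [/junk_nodata|_]; first by rewrite n.
by case: t n.
Qed.

Lemma develop_junk t : junk t -> develop t = unitt.
Proof.
by case: t => //= *; match goal with H : is_true _ |- _ => rewrite H end.
Qed.

(** The triangle property: whichever redexes a parallel step contracts, one further step completes
    it to the development. Monotonicity of [develop] follows. *)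
Lemma par_develop t t' : par t t' -> par t' (develop t).
Proof.
elim=> {t t'}; intros;
  match goal with |- par ?s (develop ?t) => case j: (junk t);
  [ rewrite (develop_junk j); apply: par_junk; apply: (junk_par _ j);
    solve [auto]
  | move: j => /= j; rewrite ?j ] end.
all: try solve [auto using par_subst1, par_subst2].
- by case: t H H0 j; case: u H1 H2; intros; try solve [auto];
    inv_par; auto.
all: try (by rewrite develop_junk).
all: case: t H H0 j; intros; try solve [auto].
(* For eliminators of ⊗, ⊕ and !, [j] says that the argument is not [nodata]; a sum or multiple
   there develops to a sum or multiple, which the commutation rule can match. *)
all: first [rewrite (develop_sup j) in H0 | rewrite (@develop_scale _ _ j) in H0
           | idtac].
all: by inv_par; auto using par_subst1, par_subst2.
Qed.

Lemma develop_par t t' : par t t' -> par (develop t) (develop t').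
Proof. by move=> p; apply/par_develop/par_develop. Qed.

(** By the triangle property and monotonicity, developments overtake any reduction path; and
    [star a] has no parallel reduct but itself. *)
Lemma steps_star_develop t a :
  steps t (star a) -> exists n, iter n develop t = star a.
Proof.
move=> p; have := clos_rt_rt1n _ _ _ _ p; move E: (star a) => v q.
elim: q E => {t v p} [t <-|t t' v st _ IH E]; first by exists 0.
have [n ev] := IH E; exists n.+1; rewrite iterSr.
have: par (iter n develop t') (iter n develop (develop t)).
  by elim: n {ev} => [|n] /=; [apply/par_develop/step_par | apply: develop_par].
by rewrite ev -E => q; inversion q.
Qed.

Lemma steps_star_inj t a b : steps t (star a) -> steps t (star b) -> a = b.
Proof.
move=> /steps_star_develop[n en] /steps_star_develop[m em].
have stable c k : iter k develop (star c) = star c.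
  by elim: k => //= k ->.
have: iter (m + n) develop t = star a by rewrite iterD en stable.
by rewrite addnC iterD em stable => -[].
Qed.

End ParallelReduction.

(** * Points of a symmetric monoidal category *)

Section Points.
Context {C : sym_mon_category}.
Implicit Types A B X Y : C.

Lemma idl_tens_inj A B (f g : hom A B) :
  idc (@Iob C) ⊗₁ f = idc Iob ⊗₁ g -> f = g.
Proof.
move=> e; have: f ∘ lam A = g ∘ lam A by rewrite -!lam_nat e.
by move/(f_equal (fun h => h ∘ lamV A)); rewrite -!comp_assoc !lamVK !comp_idr.
Qed.

Lemma idr_tens_inj A B (f g : hom A B) :
  f ⊗₁ idc (@Iob C) = g ⊗₁ idc Iob -> f = g.
Proof.
move=> e; have: f ∘ rho A = g ∘ rho A by rewrite -!rho_nat e.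
by move/(f_equal (fun h => h ∘ rhoV A)); rewrite -!comp_assoc !rhoVK !comp_idr.
Qed.

Lemma split_epi A B X (s : hom B A) (e : hom A B) (f g : hom B X) :
  e ∘ s = idc B -> f ∘ e = g ∘ e -> f = g.
Proof.
move=> es /(f_equal (fun h => h ∘ s)).
by rewrite -!comp_assoc es !comp_idr.
Qed.

Lemma split_mono A B X (s : hom B A) (m : hom A B) (f g : hom X A) :
  s ∘ m = idc A -> m ∘ f = m ∘ g -> f = g.
Proof.
move=> sm /(f_equal (fun h => s ∘ h)).
by rewrite !comp_assoc sm !comp_idl.
Qed.

Lemma tens_idl_comp A B X Y (g : hom B X) (f : hom A B) :
  idc Y ⊗₁ (g ∘ f) = (idc Y ⊗₁ g) ∘ (idc Y ⊗₁ f).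
Proof. by rewrite -tensm_comp comp_idl. Qed.

Lemma tens_idr_comp A B X Y (g : hom B X) (f : hom A B) :
  (g ∘ f) ⊗₁ idc Y = (g ⊗₁ idc Y) ∘ (f ⊗₁ idc Y).
Proof. by rewrite -tensm_comp comp_idl. Qed.

(** Kelly's argument: after tensoring with I and composing with associators, both sides are compared
    through the pentagon at [I, I, A, B] and the triangle. *)
Lemma lam_tens A B : lam (A ⊗ B) ∘ alpha Iob A B = lam A ⊗₁ idc B.
Proof.
apply: idl_tens_inj.
apply: (@split_epi _ _ _ (alphaV Iob (Iob ⊗ A) B) (alpha Iob (Iob ⊗ A) B)).
  exact: alphaVK.
apply: (@split_epi _ _ _ (alphaV Iob Iob A ⊗₁ idc B)
                         (alpha Iob Iob A ⊗₁ idc B)).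
  by rewrite -tens_idr_comp alphaVK tensm_id.
have := pentagon (@Iob C) Iob A B; rewrite -[RHS]comp_assoc => pent.
rewrite tens_idl_comp -!comp_assoc -pent.
rewrite comp_assoc triangle -tensm_id -alpha_nat.
by rewrite comp_assoc -alpha_nat -comp_assoc -tens_idr_comp triangle.
Qed.

(** Naturality of [lam] along itself gives [lam (I ⊗ I) = id ⊗ lam I]; by [lam_tens] and the
    triangle, the two unitors then agree after tensoring with I. *)
Lemma lam_rho_I : lam Iob = rho Iob :> hom (Iob ⊗ Iob) (@Iob C).
Proof.
have lamI : lam (Iob ⊗ Iob) = idc (@Iob C) ⊗₁ lam Iob.
  by apply: (@split_mono _ _ _ _ (lam Iob)) (lamK _) _; rewrite lam_nat.
by apply: idr_tens_inj; rewrite -triangle -lam_tens lamI.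
Qed.

Lemma lamV_rhoV_I : lamV Iob = rhoV Iob :> hom (@Iob C) (Iob ⊗ Iob).
Proof.
apply: (@split_mono _ _ _ _ (lam Iob)) (lamK _) _.
by rewrite lamVK lam_rho_I rhoVK.
Qed.

(* With [lam ∘ sigma = e ∘ lam], the hexagon yields [sigma = e ⊗ e], whence  *)
(* [e ∘ e = e], while [e] is an involution.                                  *)
Lemma sigma_I : sigma Iob Iob = idc (@Iob C ⊗ Iob).
Proof.
pose mu := lam (@Iob C); pose s := sigma (@Iob C) Iob.
pose e := mu ∘ s ∘ lamV Iob.
have mus : mu ∘ s = e ∘ mu by rewrite /e -comp_assoc lamK comp_idr.
have e_inv : e ∘ e = idc Iob.
  rewrite /e -!comp_assoc [lamV _ ∘ (_ ∘ _)]comp_assoc lamK comp_idl.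
  by rewrite [s ∘ (s ∘ _)]comp_assoc sigmaK comp_idl lamVK.
clearbody e.
have tri : (idc Iob ⊗₁ mu) ∘ alpha Iob Iob Iob = mu ⊗₁ idc (@Iob C).
  by rewrite triangle /mu lam_rho_I.
have sE : s = e ⊗₁ e.
  have := hexagon (@Iob C) Iob Iob.
  move/(f_equal (fun h => (idc Iob ⊗₁ mu) ∘ h)).
  rewrite !comp_assoc tri -tens_idl_comp -/s mus tens_idl_comp.
  rewrite -sigma_nat -[LHS]comp_assoc tri -/s.
  rewrite -[(_ ⊗₁ e) ∘ _ ∘ _]comp_assoc tri -[RHS]comp_assoc -tens_idr_comp mus.
  rewrite tens_idr_comp [RHS]comp_assoc -tensm_comp comp_idl comp_idr.
  apply: (@split_epi _ _ _ (lamV Iob ⊗₁ idc Iob)).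
  by rewrite -tens_idr_comp lamVK tensm_id.
have e_ee : e ∘ e = e.
  apply: (@split_epi _ _ _ (lamV Iob) mu); first exact: lamVK.
  have split : e ⊗₁ e = (idc Iob ⊗₁ e) ∘ (e ⊗₁ idc Iob).
    by rewrite -tensm_comp comp_idl comp_idr.
  rewrite -mus sE split comp_assoc lam_nat -!comp_assoc /mu lam_rho_I.
  by rewrite rho_nat.
by rewrite -/s sE -e_ee e_inv tensm_id.
Qed.

(** Coherence is handled pointwise: on tensor products of points each structural map just rearranges
    the factors, as the lemmas collected in [ptE] state. *)
Definition ptens A B (f : hom Iob A) (g : hom Iob B) : hom Iob (A ⊗ B) :=
  (f ⊗₁ g) ∘ lamV Iob.

End Points.

Notation "f ⊠ g" := (ptens f g) (at level 38, left associativity) : cat_scope.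

Section PointLemmas.
Context {C : sym_mon_category}.
Implicit Types (A B X : C) (s : hom (@Iob C) Iob).

Lemma tensm_pt A B A' B' (h : hom A A') (k : hom B B')
    (f : hom Iob A) (g : hom Iob B) :
  (h ⊗₁ k) ∘ (f ⊠ g) = (h ∘ f) ⊠ (k ∘ g).
Proof. by rewrite /ptens comp_assoc -tensm_comp. Qed.

Lemma pt_comp A B (f : hom Iob A) (g : hom Iob B) s :
  (f ∘ s) ⊠ g = (f ⊠ g) ∘ s.
Proof.
rewrite /ptens -comp_assoc lamV_rhoV_I.
rewrite -[g in LHS]comp_idr tensm_comp -!comp_assoc; f_equal.
apply: (@split_mono _ _ _ _ _ (rho Iob)) (rhoK _) _.
by rewrite !comp_assoc rho_nat rhoVK comp_idl -comp_assoc rhoVK comp_idr.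
Qed.

Lemma sigma_pt A B (f : hom Iob A) (g : hom Iob B) :
  sigma A B ∘ (f ⊠ g) = g ⊠ f.
Proof. by rewrite /ptens comp_assoc sigma_nat sigma_I comp_idr. Qed.

Lemma lam_pt A s (f : hom Iob A) : lam A ∘ (s ⊠ f) = f ∘ s.
Proof.
rewrite -[s in LHS]comp_idl pt_comp comp_assoc; f_equal.
by rewrite /ptens comp_assoc lam_nat -comp_assoc lamVK comp_idr.
Qed.

Lemma rho_pt A s (f : hom Iob A) : rho A ∘ (f ⊠ s) = f ∘ s.
Proof.
rewrite -sigma_pt -[s in LHS]comp_idl pt_comp.
rewrite [sigma _ _ ∘ _]comp_assoc sigma_pt comp_assoc; f_equal.
by rewrite /ptens comp_assoc rho_nat -comp_assoc lamV_rhoV_I rhoVK comp_idr.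
Qed.

Lemma lamV_pt A (f : hom Iob A) : lamV A ∘ f = idc Iob ⊠ f.
Proof.
apply: (@split_mono _ _ _ _ _ (lam A)) (lamK _) _.
by rewrite lam_pt comp_assoc lamVK comp_idl comp_idr.
Qed.

Lemma rhoV_pt A (f : hom Iob A) : rhoV A ∘ f = f ⊠ idc Iob.
Proof.
apply: (@split_mono _ _ _ _ _ (rho A)) (rhoK _) _.
by rewrite rho_pt comp_assoc rhoVK comp_idl comp_idr.
Qed.

Lemma alpha_pt A B X (f : hom Iob A) (g : hom Iob B) (h : hom Iob X) :
  alpha A B X ∘ (f ⊠ g ⊠ h) = f ⊠ (g ⊠ h).
Proof.
rewrite /ptens -[h in LHS]comp_idr tensm_comp comp_assoc comp_assoc alpha_nat.
rewrite -[f in RHS]comp_idr tensm_comp -!comp_assoc; f_equal.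
rewrite comp_assoc; f_equal.
apply: (@split_mono _ _ _ _ (idc Iob ⊗₁ lamV Iob) (idc Iob ⊗₁ lam Iob)).
  by rewrite -tens_idl_comp lamK tensm_id.
rewrite comp_assoc triangle -lam_rho_I -tens_idr_comp -tens_idl_comp.
by rewrite lamVK tensm_id.
Qed.

Lemma alphaV_pt A B X (f : hom Iob A) (g : hom Iob B) (h : hom Iob X) :
  alphaV A B X ∘ (f ⊠ (g ⊠ h)) = f ⊠ g ⊠ h.
Proof.
apply: (@split_mono _ _ _ _ _ (alpha A B X)) (alphaK _ _ _) _.
by rewrite alpha_pt comp_assoc alphaVK comp_idl.
Qed.

End PointLemmas.

Lemma swap_mid_pt (C : sym_mon_category) (A B X Y : C) (a : hom Iob A)
    (b : hom Iob B) (x : hom Iob X) (y : hom Iob Y) :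
  swap_mid A B X Y ∘ ((a ⊠ b) ⊠ (x ⊠ y)) = (a ⊠ x) ⊠ (b ⊠ y).
Proof.
rewrite /swap_mid -!comp_assoc alpha_pt tensm_pt -!comp_assoc alphaV_pt.
by rewrite tensm_pt sigma_pt !comp_idl alpha_pt alphaV_pt.
Qed.

Definition ptE (C : sym_mon_category) :=
  (@tensm_pt C, @sigma_pt C, @lam_pt C, @rho_pt C, @lamV_pt C, @rhoV_pt C,
   @alpha_pt C, @alphaV_pt C, @swap_mid_pt C).

(** * Addition, biproducts and exponentials *)

Section LinearMaps.
Context {C : linear_category}.
Implicit Types A B X Y : C.

Lemma pairing_prj1 X A B (f : hom X A) (g : hom X B) :
  prj1 A B ∘ pairing f g = f.
Proof. exact: pair_pi1. Qed.

Lemma pairing_prj2 X A B (f : hom X A) (g : hom X B) :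
  prj2 A B ∘ pairing f g = g.
Proof. exact: pair_pi2. Qed.

Lemma copairing_inj1 X A B (f : hom A X) (g : hom B X) :
  copairing f g ∘ inj1 A B = f.
Proof. exact: copair_in1. Qed.

Lemma copairing_inj2 X A B (f : hom A X) (g : hom B X) :
  copairing f g ∘ inj2 A B = g.
Proof. exact: copair_in2. Qed.

Lemma osum_ext X A B (h k : hom X (osum A B)) :
  prj1 A B ∘ h = prj1 A B ∘ k -> prj2 A B ∘ h = prj2 A B ∘ k -> h = k.
Proof.
rewrite [h in _ -> _ -> h = _](pair_uniq h) [k in _ -> _ -> _ = k](pair_uniq k).
by rewrite /prj1 /prj2 => -> ->.
Qed.

Lemma osum_coext X A B (h k : hom (osum A B) X) :
  h ∘ inj1 A B = k ∘ inj1 A B -> h ∘ inj2 A B = k ∘ inj2 A B -> h = k.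
Proof.
rewrite [h in _ -> _ -> h = _](copair_uniq h).
rewrite [k in _ -> _ -> _ = k](copair_uniq k).
by rewrite /inj1 /inj2 => -> ->.
Qed.

Lemma pairing_comp X Y A B (f : hom X A) (g : hom X B) (h : hom Y X) :
  pairing f g ∘ h = pairing (f ∘ h) (g ∘ h).
Proof.
by apply: osum_ext; rewrite comp_assoc ?pairing_prj1 ?pairing_prj2.
Qed.

Lemma osumm_pairing X A B A' B' (f : hom A A') (g : hom B B')
    (h : hom X A) (k : hom X B) :
  osumm f g ∘ pairing h k = pairing (f ∘ h) (g ∘ k).
Proof.
by rewrite /osumm pairing_comp -!comp_assoc pairing_prj1 pairing_prj2.
Qed.

Lemma prj1_inj1 A B : prj1 A B ∘ inj1 A B = idc A.
Proof. exact: pi1_in1. Qed.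

Lemma prj2_inj2 A B : prj2 A B ∘ inj2 A B = idc B.
Proof. exact: pi2_in2. Qed.

Lemma prj2_inj1 A B : prj2 A B ∘ inj1 A B = zero_map A B.
Proof. exact: pi2_in1. Qed.

Lemma prj1_inj2 A B : prj1 A B ∘ inj2 A B = zero_map B A.
Proof. exact: pi1_in2. Qed.

Lemma comp_zero A B X (h : hom B X) : h ∘ zero_map A B = zero_map A X.
Proof.
by rewrite /zero_map comp_assoc; congr (_ ∘ _); exact: from_zob_uniq.
Qed.

Lemma zero_comp A B X (h : hom X A) : zero_map A B ∘ h = zero_map X B.
Proof.
by rewrite /zero_map -comp_assoc; congr (_ ∘ _); exact: to_zob_uniq.
Qed.

Lemma inj1_comp X A B (f : hom X A) :
  inj1 A B ∘ f = pairing f (zero_map X B).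
Proof.
apply: osum_ext; rewrite comp_assoc ?pairing_prj1 ?pairing_prj2.
  by rewrite prj1_inj1 comp_idl.
by rewrite prj2_inj1 zero_comp.
Qed.

Lemma inj2_comp X A B (f : hom X B) :
  inj2 A B ∘ f = pairing (zero_map X A) f.
Proof.
apply: osum_ext; rewrite comp_assoc ?pairing_prj1 ?pairing_prj2.
  by rewrite prj1_inj2 zero_comp.
by rewrite prj2_inj2 comp_idl.
Qed.

Lemma addmE A B (f g : hom A B) : addm f g = codiag B ∘ pairing f g.
Proof. by rewrite /addm /diag -comp_assoc osumm_pairing !comp_idr. Qed.

Lemma addm_comp X A B (f g : hom A B) (h : hom X A) :
  addm f g ∘ h = addm (f ∘ h) (g ∘ h).
Proof. by rewrite !addmE -comp_assoc pairing_comp. Qed.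

(** [copairing] comes from the coproduct and [osumm] from the product. They are compared on
    injections, which are pairings of an identity with zero. *)
Lemma copairing_osumm A B A' B' X (f : hom A' X) (g : hom B' X)
    (h : hom A A') (k : hom B B') :
  copairing f g ∘ osumm h k = copairing (f ∘ h) (g ∘ k).
Proof.
apply: osum_coext; rewrite ?copairing_inj1 ?copairing_inj2 -comp_assoc.
  rewrite -[X in osumm _ _ ∘ X](comp_idr (inj1 A B)) inj1_comp osumm_pairing.
  by rewrite comp_idr comp_zero -inj1_comp comp_assoc copairing_inj1.
rewrite -[X in osumm _ _ ∘ X](comp_idr (inj2 A B)) inj2_comp osumm_pairing.
by rewrite comp_idr comp_zero -inj2_comp comp_assoc copairing_inj2.
Qed.

Lemma comp_copairing A B X Y (f : hom A X) (g : hom B X) (h : hom X Y) :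
  h ∘ copairing f g = copairing (h ∘ f) (h ∘ g).
Proof.
by apply: osum_coext; rewrite -comp_assoc ?copairing_inj1 ?copairing_inj2.
Qed.

Lemma comp_addm A B X (f g : hom A B) (h : hom B X) :
  h ∘ addm f g = addm (h ∘ f) (h ∘ g).
Proof.
rewrite !addmE comp_assoc comp_copairing -osumm_pairing comp_assoc.
by rewrite copairing_osumm !comp_idr !comp_idl.
Qed.

Lemma addm_zero A B (f : hom A B) : addm f (zero_map A B) = f.
Proof.
by rewrite addmE -inj1_comp comp_assoc copairing_inj1 comp_idl.
Qed.

Lemma zero_addm A B (f : hom A B) : addm (zero_map A B) f = f.
Proof.
by rewrite addmE -inj2_comp comp_assoc copairing_inj2 comp_idl.
Qed.

Lemma curry_inj A X Y (h k : hom (A ⊗ X) Y) :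
  ihomm X h ∘ eta X A = ihomm X k ∘ eta X A -> h = k.
Proof.
have uncurry (l : hom (A ⊗ X) Y) :
    ev X Y ∘ ((ihomm X l ∘ eta X A) ⊗₁ idc X) = l.
  by rewrite tens_idr_comp comp_assoc ev_nat -comp_assoc eta_ev comp_idr.
by move=> e; rewrite -(uncurry h) e uncurry.
Qed.

Lemma curry_comp A B X Y (h : hom (B ⊗ X) Y) (f : hom A B) :
  ihomm X (h ∘ (f ⊗₁ idc X)) ∘ eta X A = ihomm X h ∘ eta X B ∘ f.
Proof. by rewrite ihomm_comp -comp_assoc eta_nat comp_assoc. Qed.

Lemma curry_pt A X Y (h : hom (A ⊗ X) Y) (a : hom Iob A) (x : hom Iob X) :
  ev X Y ∘ ((ihomm X h ∘ eta X A ∘ a) ⊠ x) = h ∘ (a ⊠ x).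
Proof.
have -> : (ihomm X h ∘ eta X A ∘ a) ⊠ x
    = (ihomm X h ⊗₁ idc X) ∘ ((eta X A ⊗₁ idc X) ∘ (a ⊠ x)).
  by rewrite !tensm_pt !comp_idl comp_assoc.
by rewrite comp_assoc ev_nat -comp_assoc [ev _ _ ∘ _]comp_assoc eta_ev comp_idl.
Qed.

(** The left adjoint [- ⊗ X] preserves the initial object: currying turns maps out of [zero_ob ⊗ X]
    into maps out of [zero_ob]. *)
Lemma zero_tens A B X : zero_map A B ⊗₁ idc X = zero_map (A ⊗ X) (B ⊗ X).
Proof.
rewrite {1}/zero_map tens_idr_comp.
have -> : from_zob (bip C) B ⊗₁ idc X = zero_map (zero_ob ⊗ X) (B ⊗ X).
  apply: curry_inj.
  rewrite [LHS](from_zob_uniq (b := bip C)).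
  by rewrite [RHS](from_zob_uniq (b := bip C)).
by rewrite zero_comp.
Qed.

Lemma osum_tens_coext A B X Y (h k : hom (osum A B ⊗ X) Y) :
  h ∘ (inj1 A B ⊗₁ idc X) = k ∘ (inj1 A B ⊗₁ idc X) ->
  h ∘ (inj2 A B ⊗₁ idc X) = k ∘ (inj2 A B ⊗₁ idc X) -> h = k.
Proof.
by move=> e1 e2; apply/curry_inj/osum_coext; rewrite -!curry_comp ?e1 ?e2.
Qed.

(** The identity of a biproduct is the sum of [inj1 ∘ prj1] and [inj2 ∘ prj2]. Its tensored form
    [decomp] is inserted between the codiagonal and the pairing. *)
Lemma addm_tens A B X (f g : hom A B) :
  addm f g ⊗₁ idc X = addm (f ⊗₁ idc X) (g ⊗₁ idc X).
Proof.
have decomp : idc (osum B B ⊗ X) =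
    addm ((inj1 B B ∘ prj1 B B) ⊗₁ idc X) ((inj2 B B ∘ prj2 B B) ⊗₁ idc X).
  apply: osum_tens_coext; rewrite addm_comp -!tens_idr_comp -!comp_assoc.
    rewrite prj1_inj1 prj2_inj1 comp_zero comp_idr zero_tens.
    by rewrite addm_zero comp_idl.
  rewrite prj1_inj2 prj2_inj2 comp_zero comp_idr zero_tens.
  by rewrite zero_addm comp_idl.
rewrite addmE tens_idr_comp -[codiag B ⊗₁ _](comp_idr) decomp.
rewrite comp_addm addm_comp -!tens_idr_comp !comp_assoc.
rewrite copairing_inj1 copairing_inj2 !comp_idl.
by rewrite pairing_prj1 pairing_prj2.
Qed.

Lemma addm_pt A B (f g : hom Iob A) (h : hom Iob B) :
  addm f g ⊠ h = addm (f ⊠ h) (g ⊠ h).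
Proof.
have split (k : hom Iob A) : k ⊠ h = (k ⊗₁ idc B) ∘ (idc Iob ⊠ h).
  by rewrite tensm_pt comp_idr comp_idl.
by rewrite !split addm_tens addm_comp.
Qed.

Lemma hat_pt (a : hom Iob Iob) A (f : hom Iob A) : hat a A ∘ f = f ∘ a.
Proof. by rewrite /hat -!comp_assoc !ptE comp_idl comp_idr. Qed.

Lemma dist_pt A B X (f : hom Iob (osum A B)) (x : hom Iob X) :
  dist A B X ∘ (f ⊠ x) = pairing ((prj1 A B ∘ f) ⊠ x) ((prj2 A B ∘ f) ⊠ x).
Proof. by rewrite /dist pairing_comp !tensm_pt comp_idl. Qed.

Lemma zero_pt A X (x : hom Iob X) :
  zero_map Iob A ⊠ x = zero_map Iob (A ⊗ X).
Proof.
rewrite /ptens -[x]comp_idl -[zero_map _ _]comp_idr tensm_comp zero_tens.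
by rewrite !zero_comp.
Qed.

Lemma dist_inj1 A B X (f : hom Iob A) (x : hom Iob X) :
  dist A B X ∘ ((inj1 A B ∘ f) ⊠ x) = inj1 _ _ ∘ (f ⊠ x).
Proof.
rewrite dist_pt [prj1 _ _ ∘ _]comp_assoc [prj2 _ _ ∘ _]comp_assoc.
rewrite prj1_inj1 prj2_inj1 zero_comp comp_idl zero_pt.
by rewrite inj1_comp.
Qed.

Lemma dist_inj2 A B X (f : hom Iob B) (x : hom Iob X) :
  dist A B X ∘ ((inj2 A B ∘ f) ⊠ x) = inj2 _ _ ∘ (f ⊠ x).
Proof.
rewrite dist_pt [prj1 _ _ ∘ _]comp_assoc [prj2 _ _ ∘ _]comp_assoc.
rewrite prj1_inj2 prj2_inj2 zero_comp comp_idl zero_pt.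
by rewrite inj2_comp.
Qed.

(* These are the coalgebra morphisms from [(I, mI)] to [(!A, dlt)].          *)
Definition bang_pt A (g : hom Iob A) : hom Iob (bang_ob A) :=
  bangm (oc C) g ∘ mI (oc C).

Lemma bang_pt_eps A (g : hom Iob A) : eps (oc C) A ∘ bang_pt g = g.
Proof. by rewrite /bang_pt comp_assoc eps_nat -comp_assoc eps_mI comp_idr. Qed.

Lemma bang_pt_ee A (g : hom Iob A) : ee A ∘ bang_pt g = idc Iob.
Proof. by rewrite /bang_pt comp_assoc ee_nat ee_mI. Qed.

Lemma bang_pt_dd A (g : hom Iob A) : dd A ∘ bang_pt g = bang_pt g ⊠ bang_pt g.
Proof.
by rewrite /bang_pt comp_assoc dd_nat -comp_assoc dd_mI -tensm_pt.
Qed.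

Lemma bang_pt_dlt A (g : hom Iob A) :
  dlt (oc C) A ∘ bang_pt g = bang_pt (bang_pt g).
Proof.
rewrite /bang_pt comp_assoc dlt_nat -comp_assoc dlt_mI bangm_comp.
by rewrite comp_assoc.
Qed.

Lemma bang_pt_comp A B (f : hom A B) (g : hom Iob A) :
  bangm (oc C) f ∘ bang_pt g = bang_pt (f ∘ g).
Proof. by rewrite /bang_pt bangm_comp comp_assoc. Qed.

Lemma bang_pt_id : bang_pt (idc Iob) = mI (oc C).
Proof. by rewrite /bang_pt bangm_id comp_idl. Qed.

(** Naturality of [mT] reduces this to identity points, where the left unit law of the monoidal
    functor ! relates [mT Iob Iob] to [mI]. *)
Lemma bang_pt_ptens A B (f : hom Iob A) (g : hom Iob B) :
  mT (oc C) A B ∘ (bang_pt f ⊠ bang_pt g) = bang_pt (f ⊠ g).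
Proof.
rewrite /bang_pt -tensm_pt comp_assoc mT_nat /ptens bangm_comp -!comp_assoc.
f_equal; apply: (@split_mono _ _ _ _ (bangm (oc C) (lamV Iob))
                                     (bangm (oc C) (lam Iob))).
  by rewrite -bangm_comp lamK bangm_id.
rewrite [RHS]comp_assoc -bangm_comp lamVK bangm_id comp_idl.
have -> : mI (oc C) ⊗₁ mI (oc C)
    = (mI (oc C) ⊗₁ idc _) ∘ (idc Iob ⊗₁ mI (oc C)).
  by rewrite -tensm_comp comp_idl comp_idr.
rewrite !comp_assoc mT_lam lam_nat -comp_assoc lamVK.
by rewrite comp_idr.
Qed.

End LinearMaps.

(** * The logical relation *)

Section Steps.
Context {S : comPzSemiRingType}.
Implicit Types (t u v w : tm S) (A B : ty).

Lemma steps_refl t : steps t t.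
Proof. exact: rt_refl. Qed.

Lemma steps_trans t u v : steps t u -> steps u v -> steps t v.
Proof. exact: rt_trans. Qed.

Lemma steps_map (F : tm S -> tm S) :
  (forall t u, step t u -> step (F t) (F u)) ->
  forall t u, steps t u -> steps (F t) (F u).
Proof.
move=> mono t u; elim=> {t u} [t u /mono|t|t u v _ IH1 _ IH2].
- exact: rt_step.
- exact: rt_refl.
- exact: rt_trans IH1 IH2.
Qed.

Lemma steps_sup t t' u u' :
  steps t t' -> steps u u' -> steps (sup t u) (sup t' u').
Proof.
move=> st su; apply: (@steps_trans _ (sup t' u)).
  by apply: (steps_map (F := fun t => sup t u)) st => *; constructor.
by apply: steps_map su => *; constructor.
Qed.

Lemma steps_scale a t t' : steps t t' -> steps (scale a t) (scale a t').
Proof. by apply: steps_map => *; constructor. Qed.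

End Steps.

(* Unlike [rewrite -!comp_assoc] and [rewrite !comp_assoc], these do not     *)
(* unfold constants.                                                         *)
Ltac assoc := repeat rewrite <- comp_assoc.
Ltac assocl := repeat rewrite -> comp_assoc.

Section LogicalRelation.
Context {C : linear_category} {S : comPzSemiRingType}.
Variable scal : S -> hom (Iob : C) Iob.
Hypothesis scalM : forall a b, scal (a * b)%R = scal a ∘ scal b.
Hypothesis scalD : forall a b, scal (a + b)%R = addm (scal a) (scal b).
Implicit Types (t u v w : tm S) (A B : ty) (s : nat -> tm S).

(* A term of type A ⊗ B, A ⊕ B or !A reduces to a linear combination of      *)
(* introductions, as no rule brings ⊞ or • inside these.                     *)
Inductive lincomb (X : C) (P : tm S -> hom Iob X -> Prop) :
    tm S -> hom Iob X -> Prop :=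
| lincomb_intro t v f : steps t v -> P v f -> lincomb P t f
| lincomb_sup t t1 t2 f1 f2 :
    steps t (sup t1 t2) -> lincomb P t1 f1 -> lincomb P t2 f2 ->
    lincomb P t (addm f1 f2)
| lincomb_scale t a t1 f :
    steps t (scale a t1) -> lincomb P t1 f -> lincomb P t (f ∘ scal a).

(** At 1, ⊸, ⊤ and &, sums and multiples of introductions reduce to introductions, so an
    introduction is demanded outright. The abstraction carries the annotation [A] because
    [h_sup_lam] adds only abstractions with equal annotations. *)
Fixpoint denotes A : tm S -> hom Iob (@ity C A) -> Prop :=
  match A with
  | One => fun t f => exists2 a, steps t (star a) & f = scal a
  | Lolli A B => fun t f =>
      exists2 t', steps t (lamt A t') &
      forall u g, denotes u g -> denotes (subst1 u t') (ev _ _ ∘ (f ⊠ g))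
  | Tensor A B => lincomb (fun v f =>
      exists u w g h,
        [/\ v = tenst u w, denotes u g, denotes w h & f = g ⊠ h])
  | Top => fun t _ => steps t unitt
  | Zero => fun _ _ => False
  | With A B => fun t f =>
      exists t1 t2, [/\ steps t (pairt t1 t2),
        denotes t1 (prj1 _ _ ∘ f) & denotes t2 (prj2 _ _ ∘ f)]
  | Plus A B => lincomb (fun v f =>
      (exists u g, [/\ v = inlt u, denotes u g & f = inj1 _ _ ∘ g]) \/
      (exists u g, [/\ v = inrt u, denotes u g & f = inj2 _ _ ∘ g]))
  | Bang A => lincomb (fun v f =>
      exists u g, [/\ v = bangt u, denotes u g & f = bang_pt g])
  end.
Arguments denotes : clear implicits.

Lemma lincomb_steps X (P : tm S -> hom Iob X -> Prop) t u f :
  steps t u -> lincomb P u f -> lincomb P t f.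
Proof.
move=> tu p; case: p tu => {u f} [u v f|u u1 u2 f1 f2|u a u1 f] us.
- by move=> Pv /steps_trans/(_ us) tv; apply: lincomb_intro Pv.
- by move=> p1 p2 /steps_trans/(_ us) tv; apply: lincomb_sup p1 p2.
- by move=> p1 /steps_trans/(_ us) tv; apply: lincomb_scale p1.
Qed.

Lemma denotes_steps A t u f : steps t u -> denotes A u f -> denotes A t f.
Proof.
case: A f => //=; try by [move=> *; apply: lincomb_steps; eauto].
- by move=> f tu [a ua ->]; exists a => //; apply: steps_trans ua.
- by move=> A B f tu [u' us ru]; exists u' => //; apply: steps_trans us.
- by move=> _; apply: steps_trans.
- by move=> A B f tu [u1 [u2 [us r1 r2]]]; exists u1, u2; split=> //;
    apply: steps_trans us.
Qed.

Lemma denotes_head A t u f : head_step t u -> denotes A u f -> denotes A t f.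
Proof. by move=> tu; apply/denotes_steps/rt_step/s_head. Qed.

Lemma denotes_sup A t u f g :
  denotes A t f -> denotes A u g -> denotes A (sup t u) (addm f g).
Proof.
elim: A t u f g => //=.
- move=> t u _ _ [a ta ->] [b ub ->]; exists (a + b)%R => //.
  apply: steps_trans (steps_sup ta ub) _.
  exact/rt_step/s_head/h_sup_star.
- move=> A _ B IHB t u f g [t' ts rt] [u' us ru]; exists (sup t' u').
    apply: steps_trans (steps_sup ts us) _.
    exact/rt_step/s_head/h_sup_lam.
  move=> w h rw; rewrite addm_pt comp_addm.
  by apply: IHB; [apply: rt | apply: ru].
- by move=> *; apply: lincomb_sup (steps_refl _) _ _.
- move=> t u _ _ ts us; apply: steps_trans (steps_sup ts us) _.
  exact/rt_step/s_head/h_sup_unit.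
- move=> A IHA B IHB t u f g [t1 [t2 [ts r1 r2]]] [u1 [u2 [us q1 q2]]].
  exists (sup t1 u1), (sup t2 u2); rewrite !comp_addm; split; auto.
  apply: steps_trans (steps_sup ts us) _.
  exact/rt_step/s_head/h_sup_pair.
- by move=> *; apply: lincomb_sup (steps_refl _) _ _.
- by move=> *; apply: lincomb_sup (steps_refl _) _ _.
Qed.

Lemma denotes_scale A a t f :
  denotes A t f -> denotes A (scale a t) (f ∘ scal a).
Proof.
elim: A t f => //=.
(* The calculus yields [a * b] and the model [scal b ∘ scal a]; commutativity of the semiring
   reconciles them. *)
- move=> t _ [b ta ->]; exists (a * b)%R; last by rewrite mulrC scalM.
  apply: steps_trans (steps_scale a ta) _.
  exact/rt_step/s_head/h_scale_star.
- move=> A _ B IHB t f [t' ts rt]; exists (scale a t').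
    apply: steps_trans (steps_scale a ts) _.
    exact/rt_step/s_head/h_scale_lam.
  by move=> w h rw; rewrite pt_comp comp_assoc; apply/IHB/rt.
- by move=> *; apply: lincomb_scale (steps_refl _) _.
- move=> t _ ts; apply: steps_trans (steps_scale a ts) _.
  exact/rt_step/s_head/h_scale_unit.
- move=> A IHA B IHB t f [t1 [t2 [ts r1 r2]]].
  exists (scale a t1), (scale a t2); rewrite !comp_assoc; split; auto.
  apply: steps_trans (steps_scale a ts) _.
  exact/rt_step/s_head/h_scale_pair.
- by move=> *; apply: lincomb_scale (steps_refl _) _.
- by move=> *; apply: lincomb_scale (steps_refl _) _.
Qed.

(** [E] is an eliminator as a function of its argument, and [y] the point for its other premises.
    The map sending [f] to [k ∘ (f ⊠ y)] is linear, just as [E] commutes with ⊞ and •, so only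
    introductions have to be checked. *)
Lemma lincomb_elim (X Y : C) (P : tm S -> hom Iob X -> Prop) A
    (E : tm S -> tm S) (k : hom (X ⊗ Y) (ity A)) (y : hom Iob Y) t f :
  (forall t u, step t u -> step (E t) (E u)) ->
  (forall t u, head_step (E (sup t u)) (sup (E t) (E u))) ->
  (forall a t, head_step (E (scale a t)) (scale a (E t))) ->
  (forall v f, P v f -> denotes A (E v) (k ∘ (f ⊠ y))) ->
  lincomb P t f -> denotes A (E t) (k ∘ (f ⊠ y)).
Proof.
move=> Estep Esup Escale Eintro.
elim=> {t f} [t v f tv|t t1 t2 f1 f2 ts _ IH1 _ IH2|t a t1 f ts _ IH].
- by move/Eintro; apply/denotes_steps/steps_map.
- rewrite addm_pt comp_addm.
  apply: denotes_steps (steps_map Estep ts) _.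
  by apply: denotes_head (Esup _ _) _; apply: denotes_sup.
- rewrite pt_comp comp_assoc.
  apply: denotes_steps (steps_map Estep ts) _.
  by apply: denotes_head (Escale _ _) _; apply: denotes_scale.
Qed.

(** * Substitutions matched with points of contexts *)

Section Environments.
Variables (F : ty -> C) (P : forall A, tm S -> hom Iob (F A) -> Prop).

(** One substitution serves both contexts of a judgement: a [None] entry consumes an index but
    constrains neither term nor point. [F] and [P] vary so as to cover linear and intuitionistic
    contexts. *)
Fixpoint env (G : ctx) s : hom Iob (ictx F G) -> Prop :=
  match G return hom Iob (ictx F G) -> Prop with
  | [::] => fun g => g = idc Iob
  | None :: G' => fun g => @env G' (fun x => s x.+1) g
  | Some A :: G' => fun g =>
      exists g' f, [/\ @env G' (fun x => s x.+1) g', P (s 0) f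
                     & g = snoc F (types G') A ∘ (g' ⊠ f)]
  end.
Arguments env : clear implicits.

Lemma unsnoc_snoc l A : unsnoc F l A ∘ snoc F l A = idc _.
Proof. by case: l => [|B l] /=; rewrite ?lamK ?comp_idl. Qed.

Lemma env_empty G s g (z : Empty G) : env G s g -> empty_map F z ∘ g = idc Iob.
Proof.
elim: z s g => [|{}G z IH] s g /=; first by move=> ->; rewrite comp_idl.
exact: IH.
Qed.

Lemma env_emptyV G s g (z : Empty G) : env G s g -> empty_mapV F z = g.
Proof. by elim: z s g => [|{}G z IH] s g //=; apply: IH. Qed.

Lemma env_single A x G s g (q : Single A x G) :
  env G s g -> P (s x) (single_map F q ∘ g).
Proof.
elim: q s g => [{}G z|{}x {}G q IH] s g /=; last exact: IH.
move=> [g' [f [eg pf ->]]].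
assoc; rewrite [unsnoc _ _ _ ∘ _]comp_assoc unsnoc_snoc comp_idl.
by rewrite tensm_pt lam_pt (env_empty z eg) comp_idl comp_idr.
Qed.

Lemma env_merge G D E s g (m : Merge G D E) :
  env E s g -> exists g1 g2,
    [/\ env G s g1, env D s g2 & Defs.merge_map F m ∘ g = g1 ⊠ g2].
Proof.
elim: m s g => [|{}G {}D {}E m IH|A {}G {}D {}E m IH|A {}G {}D {}E m IH] s g /=.
- by move=> ->; exists (idc _), (idc _); split=> //; rewrite lamV_pt.
- exact: IH.
- move=> [g' [f [/IH[g1 [g2 [e1 e2 e]]] pf ->]]].
  exists (snoc F (types G) A ∘ (g1 ⊠ f)), g2; split=> //.
    by exists g1, f.
  assoc; rewrite [unsnoc _ _ _ ∘ _]comp_assoc unsnoc_snoc comp_idl.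
  by rewrite tensm_pt e !ptE !comp_idl.
- move=> [g' [f [/IH[g1 [g2 [e1 e2 e]]] pf ->]]].
  exists g1, (snoc F (types D) A ∘ (g2 ⊠ f)); split=> //.
    by exists g2, f.
  assoc; rewrite [unsnoc _ _ _ ∘ _]comp_assoc unsnoc_snoc comp_idl.
  by rewrite tensm_pt e !ptE !comp_idl.
Qed.

End Environments.
Arguments env {F} P G s g.

(** An intuitionistic variable is replaced by [t], not by [!t]; only the point is promoted. *)
Definition denotes_bang A t (h : hom Iob (@ibang C A)) : Prop :=
  exists2 f, denotes A t f & h = bang_pt f.

Definition lenv := env denotes.
Definition ienv := env denotes_bang.
Arguments lenv : clear implicits.
Arguments ienv : clear implicits.

(** Points that the structure maps of an intuitionistic context erase, copy and promote. *)
Definition coalg_pt l (g : hom Iob (itens (@ibang C) l)) : Prop :=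
  [/\ e_list l ∘ g = idc Iob, d_list l ∘ g = g ⊠ g
    & dlt_list l ∘ g = bang_pt g].

Lemma coalg_pt_snoc l A g (f : hom Iob (ity A)) :
  coalg_pt g -> coalg_pt (snoc ibang l A ∘ (g ⊠ bang_pt f)).
Proof.
(* A one-element context denotes !A rather than I ⊗ !A, hence the separate case of empty [l]. *)
rewrite /coalg_pt; case: l g => [|B l] g [/=].
  rewrite comp_idl => -> _ _; rewrite lam_pt comp_idr.
  by rewrite bang_pt_ee bang_pt_dd bang_pt_dlt.
rewrite comp_idl => eg dg deg.
assoc; rewrite !tensm_pt eg dg deg bang_pt_ee bang_pt_dd bang_pt_dlt.
by rewrite lam_pt comp_idl swap_mid_pt bang_pt_ptens.
Qed.

Lemma ienv_coalg U s g : ienv U s g -> @coalg_pt (types U) g.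
Proof.
elim: U s g => [|[A|] U IH] s g /=; last exact: IH.
  move=> ->; rewrite /coalg_pt /= comp_idl lamV_pt comp_idr; split=> //.
  by rewrite bang_pt_id.
by move=> [g' [_ [/IH cg [f rf ->] ->]]]; apply: coalg_pt_snoc.
Qed.

(** The comonoid structure copies [g] to both premises, while [m] splits [h] between them. *)
Lemma env_dbar U G D E (m : Merge G D E) s g h :
  ienv U s g -> lenv E s h -> exists h1 h2,
  [/\ lenv G s h1, lenv D s h2 & dbar U m ∘ (g ⊠ h) = (g ⊠ h1) ⊠ (g ⊠ h2)].
Proof.
move=> /ienv_coalg[_ dg _] /(env_merge m)[h1 [h2 [e1 e2 e]]].
exists h1, h2; split=> //.
by rewrite /dbar -comp_assoc tensm_pt dg e swap_mid_pt.
Qed.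

Lemma ext_pt U G A (g : hom Iob (@iint C U)) (h : hom Iob (@ilin C G))
    (f : hom Iob (ity A)) :
  ext U G A ∘ ((g ⊠ h) ⊠ f) = g ⊠ (snoc ity (types G) A ∘ (h ⊠ f)).
Proof. by rewrite /ext -comp_assoc !ptE comp_idl. Qed.

(** Quantifying over [s], [g] and [h] lets a premise under a binder be used with the substituted
    argument prepended to [s]. *)
Lemma fundamental U G t A (p : typed U G t A) s g h :
  ienv U s g -> lenv G s h -> denotes A (subst s t) (interp scal p ∘ (g ⊠ h)).
Proof.
elim: p s g h => {U G t A}.
- move=> U G x A q s g h eg eh; rewrite [interp _ _]/= [subst _ _]/=.
  have [e _ _] := ienv_coalg eg.
  by rewrite -comp_assoc !ptE e comp_idr; apply: env_single q eh.
- move=> U X U' G x A m q z s g h eg eh; rewrite [interp _ _]/= [subst _ _]/=.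
  have [g1 [g2 [e1 e2 e]]] := env_merge m eg.
  have [e1' _ _] := ienv_coalg e1.
  (* The counit recovers from the promoted point the point [f] related to the substituted term. *)
  have [f rf hf] := env_single q e2.
  assoc; rewrite !ptE (env_empty z eh) !comp_idl comp_idr e !ptE e1' comp_idr.
  by assoc; rewrite hf bang_pt_eps.
- move=> U G t u A pt IHt pu IHu s g h eg eh.
  have -> : interp scal (ty_sup pt pu) = addm (interp scal pt) (interp scal pu).
    by [].
  by rewrite addm_comp; apply: denotes_sup; auto.
- move=> U G a t A pt IHt s g h eg eh; rewrite [interp _ _]/= [subst _ _]/=.
  by assoc; rewrite hat_pt; apply: denotes_scale; auto.
- move=> U G a z s g h eg eh; rewrite [interp _ _]/= [subst _ _]/=.
  exists a; first exact: steps_refl.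
  have [e _ _] := ienv_coalg eg.
  by assoc; rewrite !ptE (env_empty z eh) !comp_idl comp_idr e comp_idr.
- move=> U G D E t u A m pt IHt pu IHu s g h eg eh.
  rewrite [interp _ _]/= [subst _ _]/=.
  have [h1 [h2 [e1 e2 e]]] := env_dbar m eg eh.
  have /= [a ta fa] := IHt _ _ _ eg e1.
  assoc; rewrite e !ptE fa.
  apply: denotes_steps.
    by apply: (steps_map (F := fun t => let_one t _)) ta => *; constructor.
  by apply: denotes_head (h_one _ _) _; apply: denotes_scale; auto.
- move=> U G A t B pt IHt s g h eg eh; rewrite [interp _ _]/= [subst _ _]/=.
  exists (subst (up_sub s) t); first exact: steps_refl.
  move=> u f rf; rewrite subst1_up_sub curry_pt; assoc; rewrite ext_pt.
  by apply: IHt => //; exists h, f.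
- move=> U G D E t u A B m pu IHu pt IHt s g h eg eh.
  rewrite [interp _ _]/= [subst _ _]/=.
  have [h1 [h2 [e1 e2 e]]] := env_dbar m eg eh.
  assoc; rewrite e tensm_pt sigma_pt.
  have [t' ts rt] := IHt _ _ _ eg e2.
  apply: denotes_steps.
    by apply: (steps_map (F := fun t => app t _)) ts => *; constructor.
  by apply: denotes_head (h_beta _ _ _) _; apply: rt; apply: IHu.
- move=> U G D E t u A B m pt IHt pu IHu s g h eg eh.
  rewrite [interp _ _]/= [subst _ _]/=.
  have [h1 [h2 [e1 e2 e]]] := env_dbar m eg eh.
  assoc; rewrite e tensm_pt; apply: lincomb_intro (steps_refl _) _.
  exists (subst s t), (subst s u).
  exists (interp scal pt ∘ (g ⊠ h1)), (interp scal pu ∘ (g ⊠ h2)).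
  by split=> //; [apply: IHt | apply: IHu].
- move=> U G D E t A B u B' m pt IHt pu IHu s g h eg eh.
  rewrite [interp _ _]/= [subst _ _]/=.
  have [h1 [h2 [e1 e2 e]]] := env_dbar m eg eh.
  (* The maps applied after the interpretation of the eliminated term are gathered into the [k] of
     [lincomb_elim], with [g ⊠ h2] as [y]. *)
  assoc; rewrite e tensm_pt comp_idl; assocl.
  apply: (lincomb_elim (E := fun t => let_tens t A B _) _ _ _ _
    (IHt _ _ _ eg e1)).
  + by move=> *; constructor.
  + by move=> *; constructor.
  + by move=> *; constructor.
  + move=> _ _ [v [w [f1 [f2 [-> rv rw ->]]]]].
    assoc; rewrite !ptE comp_idl !ext_pt.
    apply: denotes_head (h_tens _ _ _ _ _) _; rewrite subst2_up_sub.
    apply: IHu => //.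
    by exists (snoc ity (types D) A ∘ (h2 ⊠ f1)), f2; split=> //; exists h2, f1.
- by move=> *; apply: steps_refl.
- move=> U G D E t A m pt IHt s g h eg eh.
  have [h1 [h2 [e1 e2 e]]] := env_dbar m eg eh.
  (* Nothing is related at [Zero], so the premise is contradictory. *)
  by case: (IHt _ _ _ eg e1).
- move=> U G t u A B pt IHt pu IHu s g h eg eh.
  rewrite [interp _ _]/= [subst _ _]/=.
  have -> : osumm (interp scal pt) (interp scal pu) ∘ diag (iint U ⊗ ilin G)
      ∘ (g ⊠ h)
    = pairing (interp scal pt ∘ (g ⊠ h)) (interp scal pu ∘ (g ⊠ h)).
    by rewrite /diag osumm_pairing !comp_idr pairing_comp.
  exists (subst s t), (subst s u); rewrite pairing_prj1 pairing_prj2.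
  by split; [apply: steps_refl | apply: IHt | apply: IHu].
- move=> U G D E t A B u B' m pt IHt pu IHu s g h eg eh.
  rewrite [interp _ _]/= [subst _ _]/=.
  have [h1 [h2 [e1 e2 e]]] := env_dbar m eg eh.
  have [t1 [t2 [ts r1 _]]] := IHt _ _ _ eg e1.
  assoc; rewrite e !ptE !comp_idl ext_pt.
  apply: denotes_steps.
    by apply: (steps_map (F := fun t => let_fst t A _)) ts => *; constructor.
  apply: denotes_head (h_fst _ _ _ _) _; rewrite subst1_up_sub.
  by apply: IHu => //; exists h2, (prj1 _ _ ∘ (interp scal pt ∘ (g ⊠ h1))).
- move=> U G D E t A B u B' m pt IHt pu IHu s g h eg eh.
  rewrite [interp _ _]/= [subst _ _]/=.
  have [h1 [h2 [e1 e2 e]]] := env_dbar m eg eh.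
  have [t1 [t2 [ts _ r2]]] := IHt _ _ _ eg e1.
  assoc; rewrite e !ptE !comp_idl ext_pt.
  apply: denotes_steps.
    by apply: (steps_map (F := fun t => let_snd t B _)) ts => *; constructor.
  apply: denotes_head (h_snd _ _ _ _) _; rewrite subst1_up_sub.
  by apply: IHu => //; exists h2, (prj2 _ _ ∘ (interp scal pt ∘ (g ⊠ h1))).
- move=> U G t A B pt IHt s g h eg eh; rewrite [interp _ _]/= [subst _ _]/=.
  apply: lincomb_intro (steps_refl _) _; left.
  exists (subst s t), (interp scal pt ∘ (g ⊠ h)).
  by split; [| apply: IHt | rewrite comp_assoc].
- move=> U G t A B pt IHt s g h eg eh; rewrite [interp _ _]/= [subst _ _]/=.
  apply: lincomb_intro (steps_refl _) _; right.
  exists (subst s t), (interp scal pt ∘ (g ⊠ h)).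
  by split; [| apply: IHt | rewrite comp_assoc].
- move=> U G D E t A u B v B' m pt IHt pu IHu pv IHv s g h eg eh.
  rewrite [interp _ _]/= [subst _ _]/=.
  have [h1 [h2 [e1 e2 e]]] := env_dbar m eg eh.
  assoc; rewrite e tensm_pt comp_idl; assocl; rewrite copairing_osumm.
  apply: (lincomb_elim (E := fun t => case_plus t A _ B _) _ _ _ _
    (IHt _ _ _ eg e1)).
  + by move=> *; constructor.
  + by move=> *; constructor.
  + by move=> *; constructor.
  + move=> _ _ [] [w [f [-> rw ->]]]; rewrite -comp_assoc.
      rewrite dist_inj1 comp_assoc copairing_inj1; assoc.
      rewrite sigma_pt ext_pt.
      apply: denotes_head (h_inl _ _ _ _ _) _; rewrite subst1_up_sub.
      by apply: IHu => //; exists h2, f.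
    rewrite dist_inj2 comp_assoc copairing_inj2; assoc.
    rewrite sigma_pt ext_pt.
    apply: denotes_head (h_inr _ _ _ _ _) _; rewrite subst1_up_sub.
    by apply: IHv => //; exists h2, f.
- move=> U G t A z pt IHt s g h eg eh; rewrite [interp _ _]/= [subst _ _]/=.
  (* As [dlt_ctx] promotes [g], functoriality of ! turns the interpretation into [bang_pt] of the
     value of the premise. *)
  have [_ _ e] := ienv_coalg eg.
  apply: lincomb_intro (steps_refl _) _.
  exists (subst s t), (interp scal pt ∘ (g ⊠ h)); split=> //; first exact: IHt.
  assoc; rewrite tensm_pt (env_empty z eh) rho_pt comp_idr comp_idl e.
  by rewrite !bang_pt_comp rhoV_pt -comp_assoc tensm_pt comp_idl comp_idr
    (env_emptyV z eh).
- move=> U G D E t A u B m pt IHt pu IHu s g h eg eh.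
  rewrite [interp _ _]/= [subst _ _]/=.
  have [h1 [h2 [e1 e2 e]]] := env_dbar m eg eh.
  assoc; rewrite e tensm_pt comp_idl; assocl.
  apply: (lincomb_elim (E := fun t => let_bang t A _) _ _ _ _
    (IHt _ _ _ eg e1)).
  + by move=> *; constructor.
  + by move=> *; constructor.
  + by move=> *; constructor.
  + move=> _ _ [v [f [-> rv ->]]].
    assoc; rewrite !ptE !comp_idl.
    apply: denotes_head (h_bang _ _ _) _; rewrite subst1_up_sub.
    apply: IHu => //.
    by exists g, (bang_pt f); split=> //; exists f.
Qed.

End LogicalRelation.
Arguments denotes {C S} scal A t f.

Theorem theorem3p44 (S : comPzSemiRingType) (C : linear_category)
    (scal : S -> hom (@Iob C) Iob) (hscal : semiring_monomorphism scal)
    (A : ty) (t r : tm S)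
    (dt : typed [::] [::] t A) (dr : typed [::] [::] r A) :
  interp scal dt = interp scal dr -> obs_equiv A t r.
Proof.
case: hscal => scal_inj [_ scalD] _ scalM.
(* Any substitution matches the empty contexts; [var] is taken because it leaves [u] unchanged. *)
have closed (u : tm S) (du : typed [::] [::] u A) :
    denotes scal A u (interp scal du ∘ (idc Iob ⊠ idc Iob)).
  rewrite -[u in denotes _ _ u _](@subst_var _ u var) //.
  exact: fundamental.
move=> edr K c _ typedK.
pose f := interp scal dt ∘ (idc Iob ⊠ idc Iob).
have rt : denotes scal A t f := closed t dt.
have rr : denotes scal A r f by rewrite /f edr; apply: closed.
(* [k] is chosen before [u]: it depends only on [f] and the derivation of [K], so [t] and [r] share
   it. *)
have [k Kk] : exists k, forall u, denotes scal A u f ->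
    denotes scal One (fill K u) k.
  case: typedK => -[dK]; eexists => u ru; apply: (fundamental scalM scalD dK).
  - by exists (idc Iob), (bang_pt f); split=> //; exists f.
  - by [].
  - by [].
  - by exists (idc Iob), f.
have [b tb kb] := Kk _ rt; have [b' rb kb'] := Kk _ rr.
have bb' : b' = b by apply: scal_inj; rewrite -kb.
rewrite bb' in rb.
by split=> [/steps_star_inj/(_ tb)|/steps_star_inj/(_ rb)] ->.
Qed.
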